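(* Let $(w_n)_{n\ge 0}$ and $(v_k)_{k\ge 1}$ be sequences of nonnegative reals with $W(z)=\sum_{n\ge0}w_nz^n$, and assume there are $\rho_w>0$, $\alpha>-1$ and slowly varying $L_w,L_v$ with $$w_n\sim L_w(n)\,n^{-1}\rho_w^{-n},\qquad W(\rho_w)\in(0,\infty),\qquad v_n\sim L_v(n)\,n^{\alpha-1}W(\rho_w)^{-n}.$$ Let $X$ have probability generating function $W(\rho_w z)/W(\rho_w)$. Let $(K_1,\dots,K_{N_n})$ follow the Gibbs partition model $\mathbb{P}_n$, and let $\tilde X_1,\tilde X_2,\dots$ be i.i.d. copies of $(X\mid X\le n)$, independent of $N_n$. Then, as $n\to\infty$, $$d_{\mathrm{TV}}\Big(\mathcal{L}\big(\tau(K_1,\dots,K_{N_n})\big),\ \mathcal{L}\big(\tilde X_1,\dots,\tilde X_{N_n-1}\big)\Big)\to0.$$ Consequently, if $K_{(1)}\ge K_{(2)}\ge\cdots$ denote the components ordered decreasingly, then $K_{(1)}/n\to1$ in probability and $K_{(2)}=o_p(n)$ (i.e. $K_{(2)}/n\to 0$ in probability).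
   Context: For $k\ge1$ set $w_n^{(k)}=\sum_{n_1+\dots+n_k=n,\ n_i\ge0}\prod_{i=1}^k w_{n_i}$ and $u_n=\sum_{k\ge1}v_k w_n^{(k)}$. For $n$ with $0<u_n<\infty$, the Gibbs partition model is the probability measure on finite sequences $(n_1,\dots,n_k)$ ($k\ge1$) of nonnegative integers summing to $n$ given by $\mathbb{P}_n(n_1,\dots,n_k)=v_k\prod_{i=1}^k w_{n_i}/u_n$; $(K_1,\dots,K_{N_n})$ denotes a random sequence with this law. The ''delete first maximum'' operator $\tau:\bigcup_{k\ge1}\mathbb{N}_0^k\to\bigcup_{k\ge0}\mathbb{N}_0^k$ maps $(x_1,\dots,x_k)$ to $(x_1,\dots,x_{J-1},x_{J+1},\dots,x_k)$ where $J=\min\{j: x_j=\max_i x_i\}$. $d_{\mathrm{TV}}$ is total variation distance on laws of finite sequences. *)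

(* Defs.v *)
From HB Require Import structures.
From mathcomp Require Import all_boot all_order all_algebra.
From mathcomp Require Import all_classical all_reals all_analysis.
Set Implicit Arguments. Unset Strict Implicit. Unset Printing Implicit Defensive.
Import Order.TTheory GRing.Theory Num.Theory.
Import numFieldNormedType.Exports.
Local Open Scope classical_set_scope.
Local Open Scope ring_scope.

Section Defs.
Variable R : realType.

Definition slowly_varying (L : R -> R) : Prop :=
  (exists x0 : R, (forall x, x0 <= x -> 0 < L x) /\
                  measurable_fun [set x | x0 <= x] L) /\
  (forall lam : R, 0 < lam ->
     (fun x => L (lam * x) / L x) x @[x --> +oo] --> (1 : R)).

Definition asymp_equiv (a b : nat -> R) : Prop :=
  (fun n => a n / b n) @ \oo --> (1 : R).

Definition wconv (w : nat -> R) (k n : nat) : R :=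
  \sum_(t : {ffun 'I_k -> 'I_n.+1} | (\sum_(i < k) (t i : nat))%N == n)
     \prod_(i < k) w (t i).

Definition u_seq (w v : nat -> R) (n : nat) : \bar R :=
  (\sum_(1 <= k <oo) (v k * wconv w k n)%:E)%E.

(* Gibbs partition model P_n as a probability mass function on finite
   sequences of nonnegative integers (only meaningful when 0 < u_n < oo). *)
Definition gibbs (w v : nat -> R) (n : nat) (s : seq nat) : R :=
  if (0 < size s)%N && (sumn s == n)
  then v (size s) * \prod_(x <- s) w x / fine (u_seq w v n)
  else 0.

Definition gibbs_prob (w v : nat -> R) (n : nat) (A : set (seq nat)) : \bar R :=
  \esum_(s in A) (gibbs w v n s)%:E.

Definition tau (s : seq nat) : seq nat :=
  let J := index (\max_(x <- s) x)%N s in take J s ++ drop J.+1 s.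

Definition Wval (w : nat -> R) (rho : R) : \bar R :=
  (\sum_(0 <= m <oo) (w m * rho ^+ m)%:E)%E.

(* P(X = m) where X has pgf W(rho z)/W(rho) *)
Definition pX (w : nat -> R) (rho : R) (m : nat) : R :=
  w m * rho ^+ m / fine (Wval w rho).

Definition pXcond (w : nat -> R) (rho : R) (n m : nat) : R :=
  if (m <= n)%N then pX w rho m / (\sum_(j < n.+1) pX w rho j) else 0.

(* Law of (tilde X_1, ..., tilde X_{N_n - 1}) with tilde X_i i.i.d. ~ (X | X <= n),
   independent of N_n (= length of the Gibbs sequence): its mass at s is
   P(N_n = size s + 1) * prod_i P(X = s_i | X <= n). *)
Definition xtilde_pmf (w v : nat -> R) (rho : R) (n : nat) (s : seq nat) : \bar R :=
  (gibbs_prob w v n [set t | size t = (size s).+1] *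
   (\prod_(x <- s) pXcond w rho n x)%:E)%E.

Definition law_tauK (w v : nat -> R) (n : nat) (A : set (seq nat)) : \bar R :=
  gibbs_prob w v n (tau @^-1` A).

Definition law_xtilde (w v : nat -> R) (rho : R) (n : nat) (A : set (seq nat)) : \bar R :=
  (\esum_(s in A) xtilde_pmf w v rho n s)%E.

Definition dTV (mu nu : set (seq nat) -> \bar R) : \bar R :=
  ereal_sup [set (`|mu A - nu A|)%E | A in [set: set (seq nat)]].

Definition Kord (i : nat) (s : seq nat) : nat := nth 0%N (sort geq s) i.

End Defs.

(* Main.v *)
Require Import Defs.
From HB Require Import structures.
From mathcomp Require Import all_boot all_order all_algebra.
From mathcomp Require Import all_classical all_reals all_analysis.
From mathcomp Require Import measurable_realfun.
From mathcomp Require Import zify ring lra.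
Import Order.TTheory GRing.Theory Num.Theory.
Import numFieldNormedType.Exports.
Local Open Scope classical_set_scope.
Local Open Scope ring_scope.

(** Write [p m = P(X = m)], [F = P(X <= n)], [q k = v k * W(rho)^k], and let [S_k] be
    a sum of [k] independent copies of [X].  Since [m * p m] is slowly varying, it is
    negligible against the tail [1 - F], so that a single summand dominates [S_k]
    even for [k] of order [1 / (1 - F)].  Size biasing,
      [m * P(S_(k+1) = m) = (k+1) * sum_j j * p j * P(S_k = m - j)],
    turns this into [P(S_(k+1) = n) <= (1 + e) * (k+1) * p n * F^k] up to a remainder
    bounded by [(k+1) * p n * k * n * p n * exp (- k * (1 - F) / 2)].
    Summed against [q (k+1)] the remainder is negligible, because the Laplace
    transform of the regularly varying sequence [(k+1) * q (k+1)] has the doubling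
    property.  Conversely, inserting the entry [n - sum s] at any of the [k+1]
    positions of a sequence [s] of length [k] and small sum gives a sequence that
    [tau] maps to [s], so [tau(K)] charges [s] at least about
    [(k+1) * q (k+1) * p n * prod_i p s_i / (u_n * rho^n)], which dominates the mass
    that the truncated independent sequence gives to [s].  Sequences of large sum
    are excluded by Markov's inequality, and a one-sided comparison of two
    probability measures bounds their total variation distance. *)

(** * Uniform convergence for slowly varying functions *)

Lemma lebesgue_measure_shift (R : realType) (u : R)
    (B : set (measurableTypeR R)) :
  measurable B ->
  lebesgue_measure ((fun t : measurableTypeR R => t + u) @^-1` B) = lebesgue_measure B.
Proof.
move=> mB.
pose f : measurableTypeR R -> measurableTypeR R := fun t => t + u.
have mf : measurable_fun [set: measurableTypeR R] f.
  by apply: measurable_funD => //; exact: measurable_cst.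
rewrite (@lebesgue_measure_unique R (measure_function_pushforward__canonical__measure_function_Measure lebesgue_measure mf) _ B mB)//.
move=> X [[a b] _ <-] /=; rewrite /pushforward.
rewrite (_ : _ @^-1` _ = `]a - u, b - u]%classic); last first.
  by apply/seteqP; split => x /=; rewrite !in_itv /= ltrBlDr lerBrDr.
by rewrite !lebesgue_measure_itv /= !lte_fin ltrD2r -!EFinB opprB addrA subrK.
Qed.

(* By Egorov's theorem the increments of [h] at [x] and at [x + u] are small off
   sets of small measure; a common good point compares [h x] with [h (x + u)]. *)
Lemma additive_uniform (R : realType) (h : R -> R) :
  measurable_fun setT h ->
  (forall u, h (x + u) - h x @[x --> +oo] --> (0 : R)) ->
  forall e : R, 0 < e -> exists X : R, forall x u : R,
    X <= x -> 0 <= u <= 1 -> `|h (x + u) - h x| < e.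
Proof.
move=> mh hh e e0; apply: contrapT => /forallNP hN.
(* A failure of uniformity yields base points [z.1] tending to infinity with shifts [z.2] in the
   unit interval whose increments stay at least [e]. *)
have /choice[z zP] : forall n : nat, exists z : R * R,
    [/\ n%:R <= z.1, 0 <= z.2 <= 1 & e <= `|h (z.1 + z.2) - h z.1| ].
  move=> n; have /existsNP[x /existsNP[u /not_implyP[nx /not_implyP[u01 /negP]]]] := hN n%:R.
  by rewrite -leNgt => H; exists (x, u).
have xoo : (z n).1 @[n --> \oo] --> +oo.
  apply/cvgryPge => A; near=> n; have [+ _ _] := zP n; apply: le_trans.
  by near: n; exact: nbhs_infty_ger.
have yoo : (z n).1 + (z n).2 @[n --> \oo] --> +oo.
  apply/cvgryPge => A; near=> n; have [+ /andP[u0 _] _] := zP n.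
  move=> nx; rewrite (le_trans _ (lerD nx u0))// addr0.
  by near: n; exact: nbhs_infty_ger.
(* Length 2, since both [t] and [t + u] must lie in [D] for [t] and [u] in the unit interval. *)
pose D := `[0, 2]%classic : set (measurableTypeR R).
have AU (s : nat -> R) : s n @[n --> \oo] --> +oo -> exists B : set (measurableTypeR R),
    [/\ measurable B, (lebesgue_measure B < (2^-1 : R)%:E)%E &
     exists N, forall n t, (N <= n)%N -> D t -> ~ B t ->
        `|h (s n + t) - h (s n)| < e / 2].
  move=> soo.
  have mg n : measurable_fun D (fun t => h (s n + t) - h (s n)).
    apply: measurable_funTS; apply: measurable_funB; last exact: measurable_cst.
    by apply: measurableT_comp => //; apply: measurable_funD => //; exact: measurable_cst.
  have finD : (lebesgue_measure D < +oo)%E.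
    by rewrite lebesgue_measure_itv /=; case: ifP => _; rewrite ltry.
  have ptw t : D t -> h (s n + t) - h (s n) @[n --> \oo] --> (cst 0 t : R).
    by move=> _; have /cvg_pinftyP := hh t; apply.
  have mD : measurable D by exact: measurable_itv.
  have h20 : 0 < 2^-1 :> R by rewrite invr_gt0.
  have [B [mB muB unif]] := pointwise_almost_uniform mg mD finD ptw h20.
  exists B; split => //.
  have e20 : 0 < e / 2 by rewrite divr_gt0.
  have : nbhs (cst 0 : {uniform` D `\` B -> R})
      [set g : {uniform` D `\` B -> R} | forall t, (D `\` B) t -> `|g t| < e / 2].
    apply/uniform_nbhs; exists [set ab : R * R | `|ab.1 - ab.2| < e / 2]; split.
      by rewrite -entourage_ballE; exists (e / 2).
    by move=> g /= + t Dt => /(_ t Dt); rewrite sub0r normrN.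
  move=> /unif [N _ HN]; exists N => n t /HN /= Hn Dt Bt.
  exact: Hn.
have [B [mB muB [N HN]]] := AU _ xoo.
have [B' [mB' muB' [N' HN']]] := AU _ yoo.
pose n := maxn N N'.
have [_ /andP[u0 u1]] := zP n; set x := (z n).1; set u := (z n).2.
rewrite -/x -/u in u0 u1 * => eh.
pose C := (fun t : measurableTypeR R => t + u) @^-1` B.
have mC : measurable C.
  rewrite -[C]setTI; apply: (_ : measurable_fun setT _) => //.
  by apply: measurable_funD => //; exact: measurable_cst.
have muC : (lebesgue_measure C < (2^-1 : R)%:E)%E by rewrite lebesgue_measure_shift.
(* [B'] and [C] have measure below 1/2 each, so they cannot cover the unit interval. *)
have [t [Dt Bt Ct]] : exists t, [/\ 0 <= t <= 1, ~ B' t & ~ C t].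
  apply: contrapT => /forallNP H.
  pose I : set (measurableTypeR R) := `[(0 : R), (1 : R)]%classic.
  have sub : I `<=` B' `|` C.
    move=> t; rewrite /I /= in_itv /= => t01; have := H t.
    have [Bt|nBt] := pselect (B' t); first by left.
    have [Ct|nCt] := pselect (C t); first by right.
    by move=> []; split.
  have : (lebesgue_measure I < 1)%E.
    apply: (@le_lt_trans _ _ (lebesgue_measure (B' `|` C))).
      by apply: le_measure => //; rewrite inE; [exact: measurable_itv|exact: measurableU].
    apply: (le_lt_trans (measureU2 _ mB' mC)).
    rewrite [ltRHS](_ : _ = (2^-1 : R)%:E + (2^-1 : R)%:E)%E; last by rewrite -EFinD; congr EFin; lra.
    exact: lteD.
  by rewrite /I lebesgue_measure_itv /= lte_fin ltr01 oppr0 adde0 ltxx.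
have h1 := HN n (t + u) (leq_maxl _ _).
have h2 := HN' n t (leq_maxr _ _).
rewrite -/x -/u in h1 h2.
move: Dt => /andP[t0 t1].
have {}h1 : `|h (x + (t + u)) - h x| < e / 2.
  by apply: h1 => //; rewrite /D /= in_itv /=; apply/andP; split; lra.
have {}h2 : `|h (x + u + t) - h (x + u)| < e / 2.
  by apply: h2 => //; rewrite /D /= in_itv /=; apply/andP; split; lra.
have e1 : x + (t + u) = x + u + t by ring.
move: eh; rewrite leNgt => /negP; apply.
rewrite (_ : _ - _ = (h (x + (t + u)) - h x) - (h (x + u + t) - h (x + u))); last first.
  by rewrite e1; ring.
by rewrite [ltRHS]splitr (le_lt_trans (ler_normB _ _))// ltrD.
Unshelve. all: by end_near. Qed.

(** Passing to [ln (L (exp x))] turns ratios into additive increments, and [y <= 2 * x] gives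
    [ln y - ln x <= 1] because [2 <= exp 1]. *)
Lemma slowly_varying_uniform (R : realType) (L : R -> R) :
  slowly_varying L -> forall e : R, 0 < e -> exists2 X : R, 0 < X &
  forall x y, X <= x -> x <= y <= 2 * x ->
  [/\ 0 < L x, 0 < L y, L y <= (1 + e) * L x & L x <= (1 + e) * L y].
Proof.
move=> [[x0 [Lpos mL]] Llim] e e0.
have exp_ge (x : R) : x <= expR x by rewrite (le_trans _ (expR_ge1Dx x))// lerDr.
have expoo : expR x @[x --> +oo] --> (+oo : set_system R).
  apply/cvgryPge => A; near=> x; apply: le_trans (exp_ge x).
  by near: x; apply: nbhs_pinfty_ge; exact: num_real.
(* [L] is controlled only beyond [x0]; the maximum, with [x <= expR x], keeps the argument there and
   makes [h] measurable on the whole line. *)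
pose h (x : R) := ln (L (expR (Num.max x x0))).
have hE x : x0 <= x -> h x = ln (L (expR x)) by move=> xx0; rewrite /h (elimT max_idPl).
have mh : measurable_fun setT h.
  apply: measurableT_comp; first exact: measurable_ln.
  apply: (measurable_comp _ _ mL).
  - rewrite (_ : [set x | _] = `[x0, +oo[%classic); first exact: measurable_itv.
    by apply/seteqP; split => x /=; rewrite in_itv /= andbT.
  - by move=> _ [x _ <-] /=; rewrite (le_trans _ (exp_ge _))// le_max lexx orbT.
  - apply: measurableT_comp; first exact: measurable_expR.
    by apply: measurable_maxr; [exact: measurable_id|exact: measurable_cst].
have hh u : h (x + u) - h x @[x --> +oo] --> (0 : R).
  have H1 : L (expR u * expR x) / L (expR x) @[x --> +oo] --> (1 : R).
    exact: cvg_comp _ _ expoo (Llim _ (expR_gt0 u)).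
  have H2 : ln (L (expR u * expR x) / L (expR x)) @[x --> +oo] --> (0 : R).
    by rewrite -ln1; apply: continuous_cvg => //; exact: continuous_ln.
  apply: cvg_trans H2; apply: near_eq_cvg; near=> x.
  have xx0 : x0 <= x by near: x; apply: nbhs_pinfty_ge; exact: num_real.
  have xux0 : x0 <= x + u.
    by rewrite -lerBlDr; near: x; apply: nbhs_pinfty_ge; exact: num_real.
  rewrite !hE// expRD [expR u * _]mulrC ln_div// posrE; apply: Lpos.
    by rewrite -expRD; apply: le_trans (exp_ge _).
  exact: le_trans (exp_ge _).
have le0 : 0 < ln (1 + e) by rewrite ln_gt0// ltrDl.
have [X HX] := additive_uniform R h mh hh (ln (1 + e)) le0.
exists (expR (Num.max X x0)); first exact: expR_gt0.
move=> x y Xx /andP[xy y2x].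
have x_gt0 : 0 < x by apply: lt_le_trans Xx; exact: expR_gt0.
have y_gt0 : 0 < y by exact: lt_le_trans xy.
have lx : Num.max X x0 <= ln x by rewrite -ler_expR lnK.
have lxy : ln x <= ln y by rewrite ler_ln.
have lxX : X <= ln x by rewrite (le_trans _ lx)// le_max lexx.
have lx0 : x0 <= ln x by rewrite (le_trans _ lx)// le_max lexx orbT.
have Lx : 0 < L x by apply: Lpos; rewrite -[x]lnK// (le_trans lx0).
have Ly : 0 < L y by apply: Lpos; rewrite -[y]lnK// (le_trans lx0)// (le_trans lxy).
have lyx : ln y - ln x <= 1.
  rewrite lerBlDr -ler_expR expRD !lnK//; apply: le_trans y2x _.
  rewrite ler_pM2r//.
  by have := expR_ge1Dx (1 : R).
have : `|h (ln x + (ln y - ln x)) - h (ln x)| < ln (1 + e).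
  by apply: HX => //; rewrite subr_ge0 lxy.
rewrite subrKC !hE// ?(le_trans lx0)// !lnK//.
have e1 : 0 < 1 + e by rewrite ltr_wpDr// ltW.
rewrite ltr_norml => /andP[l1 l2]; split => //.
  rewrite -ler_ln ?posrE ?mulr_gt0// lnM ?posrE//; lra.
rewrite -ler_ln ?posrE ?mulr_gt0// lnM ?posrE//; lra.
Unshelve. all: by end_near. Qed.

(** For large [n], [a n / L n] lies within a factor [1 +- d] of [c]. With the uniform estimate for
    [L], the total loss is [(1 + d)^2 / (1 - d)], which dictates the choice of [d]. *)
Lemma slowly_varying_window (R : realType) (L : R -> R) (a : nat -> R) (c : R) :
  slowly_varying L -> 0 < c -> a n / L n%:R @[n --> \oo] --> c ->
  forall e : R, 0 < e -> exists N, forall n j, (N <= n)%N -> (j <= n <= 2 * j)%N ->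
  [/\ 0 < a n, 0 < a j, a j <= (1 + e) * a n & a n <= (1 + e) * a j].
Proof.
move=> svL c0 ac e e0.
have [d [d0 d1 dE]] : exists d : R, [/\ 0 < d, d < 1 & (1 + d) ^+ 2 <= (1 + e) * (1 - d)].
  have [e1|e1] := leP e 1.
    by exists (e / 8); split; nra.
  by exists 8^-1; split; lra.
have [X X0 HX] := slowly_varying_uniform _ _ svL _ d0.
have cd0 : 0 < c * d by rewrite mulr_gt0.
have [M _ HM] := cvgr_dist_le _ _ ac _ cd0.
have [K XK] : exists K : nat, X <= K%:R.
  exists (Num.truncn X).+1; apply: ltW; exact: truncnS_gt.
(* As [n <= 2 * j], doubling the threshold puts [j] as well as [n] past [M] and [K]. *)
exists (2 * maxn M K)%N => n j nN /andP[jn nj].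
have jMK : (maxn M K <= j)%N by lia.
have jM : (M <= j)%N by apply: leq_trans jMK; exact: leq_maxl.
have jK : (K <= j)%N by apply: leq_trans jMK; exact: leq_maxr.
have [||Lj Ln Lnj Ljn] := HX j%:R n%:R.
- by rewrite (le_trans XK)// ler_nat.
- by rewrite ler_nat jn -natrM ler_nat.
have bnd i : (M <= i)%N -> 0 < L i%:R ->
    c * (1 - d) * L i%:R <= a i <= c * (1 + d) * L i%:R.
  move=> /HM /=; rewrite ler_distlC => /andP[l1 l2] Li.
  rewrite ler_pdivlMr// in l1; rewrite ler_pdivrMr// in l2.
  by apply/andP; split; [apply: le_trans l1|apply: (le_trans l2)]; lra.
have /andP[j1 j2] := bnd j jM Lj.
have /andP[n1 n2] := bnd n (leq_trans jM jn) Ln.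
have aux i : 0 < L i%:R -> 0 < c * (1 - d) * L i%:R by move=> ?; rewrite !mulr_gt0 ?subr_gt0.
have key x y : 0 < x -> 0 < y -> y <= (1 + d) * x ->
    c * (1 + d) * y <= (1 + e) * (c * (1 - d) * x).
  move=> x0 y0 yx; apply: (@le_trans _ _ (c * x * (1 + d) ^+ 2)).
    rewrite expr2 [leRHS](_ : _ = (c * (1 + d)) * ((1 + d) * x)); last by ring.
    by rewrite ler_wpM2l// mulr_ge0// ltW// ltr_wpDr// ltW.
  rewrite [leRHS](_ : _ = (c * x) * ((1 + e) * (1 - d))); last by ring.
  by rewrite ler_wpM2l// mulr_ge0// ltW.
have e1 : 0 <= 1 + e by rewrite ltW// ltr_wpDr// ltW.
split.
- exact: lt_le_trans (aux _ Ln) n1.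
- exact: lt_le_trans (aux _ Lj) j1.
- by apply: (le_trans j2); apply: (le_trans (key _ _ Ln Lj Ljn)); rewrite ler_wpM2l.
- by apply: (le_trans n2); apply: (le_trans (key _ _ Lj Ln Lnj)); rewrite ler_wpM2l.
Qed.

(** * Powers of polynomials with nonnegative coefficients *)

Section NonnegPoly.
Context (R : realType).
Implicit Types A B : {poly R}.

Definition nonneg_poly A := forall i, 0 <= A`_i.

Lemma nonneg_polyX A k : nonneg_poly A -> nonneg_poly (A ^+ k).
Proof.
move=> A0; elim: k => [|k IH] i; first by rewrite expr0 coef1 ler0n.
by rewrite exprS coefM sumr_ge0// => j _; rewrite mulr_ge0.
Qed.

(** The right side also contains the products [A_i * B_j] with [i + j > m], all nonnegative. *)
Lemma psum_coefM A B m : nonneg_poly A -> nonneg_poly B ->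
  \sum_(i < m.+1) (A * B)`_i <= (\sum_(i < m.+1) A`_i) * (\sum_(i < m.+1) B`_i).
Proof.
move=> A0 B0.
under eq_bigr => i _ do rewrite coefM (big_ord_widen m.+1 (fun j => A`_j * B`_(i - j)))//.
under eq_bigr => i _ do rewrite big_mkcond.
rewrite exchange_big /= mulr_suml; apply: ler_sum => j _.
rewrite -big_mkcond -mulr_sumr ler_wpM2l//.
have jm : (j <= m.+1)%N by exact: ltnW.
rewrite -(big_mkord (fun i => (j < i.+1)%N) (fun i => B`_(i - j))).
rewrite (big_cat_nat (n := j))//= big_nat_cond big1 ?add0r; last by move=> i; lia.
rewrite big_nat_cond (eq_bigl (fun i => (j <= i < m.+1)%N && true)); last first.
  by move=> i; lia.
rewrite -big_nat_cond -{1}[j : nat]add0n big_addn.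
under eq_bigr => i _ do rewrite addnK.
rewrite -(big_mkord xpredT) [leRHS](big_cat_nat (n := (m.+1 - j)%N))//=; last exact: leq_subr.
by rewrite lerDl sumr_ge0.
Qed.

Lemma psum_coefX A k m : nonneg_poly A ->
  \sum_(i < m.+1) (A ^+ k)`_i <= (\sum_(i < m.+1) A`_i) ^+ k.
Proof.
move=> A0; elim: k => [|k IH].
  rewrite !expr0 big_ord_recl coef1 /= big1 ?addr0// => i _.
  by rewrite coef1.
rewrite !exprS; apply: (le_trans (psum_coefM _ _ _ A0 (nonneg_polyX _ _ A0))).
by rewrite ler_wpM2l// sumr_ge0.
Qed.

(** The size-biasing identity: compare coefficients in [(A^(k+1))' = (k+1) * A' * A^k]. *)
Lemma coef_expS_deriv A k m : m%:R * (A ^+ k.+1)`_m =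
  k.+1%:R * \sum_(j < m.+1) (j%:R * A`_j) * (A ^+ k)`_(m - j).
Proof.
case: m => [|m]; first by rewrite big_ord1 !mul0r mulr0.
transitivity ((A ^+ k.+1)^`()`_m); first by rewrite coef_deriv mulr_natl.
rewrite deriv_exp /= coefMn coefM -[LHS]mulr_natl; congr (_ * _).
rewrite [in RHS]big_ord_recl /= !mul0r add0r; apply: eq_bigr => j _.
by rewrite coef_deriv /= /bump /= add1n subSS mulr_natl.
Qed.

End NonnegPoly.

(** Each term is at most [2 * (sqrt (j+1) - sqrt j)], since the square of that difference of roots
    is nonnegative; the sum telescopes. *)
Lemma psum_inv_sqrt (R : realType) n :
  \sum_(j < n) (Num.sqrt j.+1%:R)^-1 <= 2 * Num.sqrt n%:R :> R.
Proof.
elim: n => [|n IH]; first by rewrite big_ord0 mulr_ge0.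
rewrite big_ord_recr /=; apply: (le_trans (lerD IH (lexx _))).
have s0 : 0 < Num.sqrt n.+1%:R :> R by rewrite sqrtr_gt0 ltr0n.
have n0 : 0 <= Num.sqrt n%:R :> R by [].
rewrite -lerBrDl -(ler_pM2r s0) mulVf ?gt_eqF//.
have : Num.sqrt n%:R ^+ 2 = n%:R :> R by rewrite sqr_sqrtr.
have : Num.sqrt n.+1%:R ^+ 2 = n%:R + 1 :> R by rewrite sqr_sqrtr// natr1.
have := sqr_ge0 (Num.sqrt n.+1%:R - Num.sqrt n%:R : R).
nra.
Qed.

(** * Local estimates for the sums *)

(** The form in which slow variation enters all later estimates; it is the conclusion of
    [slowly_varying_window]. *)
Definition window (R : realType) (l : nat -> R) := forall e : R, 0 < e ->
  exists N, forall n j, (N <= n)%N -> (j <= n <= 2 * j)%N ->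
  [/\ 0 < l n, 0 < l j, l j <= (1 + e) * l n & l n <= (1 + e) * l j].

Section SlowlyVaryingTail.
Context (R : realType) (p : nat -> R).
Hypothesis p_ge0 : forall n, 0 <= p n.
Hypothesis p_sum1 : \sum_(j < n) p j @[n --> \oo] --> (1 : R).

Definition wt n := n%:R * p n.
Definition tail n := 1 - \sum_(j < n.+1) p j.

Hypothesis win : window R wt.

Lemma wt_ge0 n : 0 <= wt n. Proof. by rewrite mulr_ge0. Qed.

Lemma p_wt n : (0 < n)%N -> p n = wt n / n%:R.
Proof. by move=> n0; rewrite /wt mulrAC divff ?mul1r// pnatr_eq0 -lt0n. Qed.

Lemma nondecreasing_psum : nondecreasing_seq (fun n => \sum_(j < n) p j).
Proof.
by apply/nondecreasing_seqP => n; rewrite big_ord_recr /= lerDl.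
Qed.

Lemma psum_le1 n : \sum_(j < n) p j <= 1.
Proof.
rewrite -(cvg_lim _ p_sum1)//; apply: nondecreasing_cvgn_le.
  exact: nondecreasing_psum.
by apply/cvg_ex; eexists; exact: p_sum1.
Qed.

Lemma tail_ge0 n : 0 <= tail n. Proof. by rewrite subr_ge0 psum_le1. Qed.

Lemma tail_le1 n : tail n <= 1.
Proof. by rewrite lerBlDr lerDl sumr_ge0. Qed.

Lemma tail_mono m n : (m <= n)%N -> tail n <= tail m.
Proof. by move=> mn; rewrite lerB// nondecreasing_psum. Qed.

Lemma tail_gt0 n : 0 < tail n.
Proof.
have [N HN] := win _ ltr01.
pose m := maxn N.+1 n.+1.
have [|m0 _ _ _] := HN m m (leq_trans (leqnSn _) (leq_maxl _ _)); first lia.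
have pm : 0 < p m.
  by rewrite p_wt ?divr_gt0// ?ltr0n /m; lia.
apply: lt_le_trans (_ : p m <= _); first by [].
have h : \sum_(j < n.+1) p j <= \sum_(j < m) p j by apply: nondecreasing_psum; rewrite /m; lia.
have := psum_le1 m.+1; rewrite big_ord_recr /= /tail; lra.
Qed.

Lemma tail_cvg0 (e : R) : 0 < e -> exists N, forall n, (N <= n)%N -> tail n <= e.
Proof.
move=> e0; have [N _ HN] := cvgr_dist_le _ _ p_sum1 _ e0.
exists N => n Nn; have := HN n.+1 (leq_trans Nn (leqnSn _)).
by apply: le_trans; exact: ler_norm.
Qed.

(** The block from [n+1] to [2n] has [n] terms, each at least [(wt n / 2) / (2 * n)] by the window
    property with tolerance 1. *)
Lemma tail_dyadic : exists N, forall n, (N <= n)%N -> wt n / 4 + tail (2 * n)%N <= tail n.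
Proof.
have [N HN] := win _ ltr01; exists N.+1 => n Nn.
have n0 : (0 < n)%N by lia.
rewrite /tail -!(big_mkord xpredT).
rewrite (big_cat_nat (n := n.+1) (p := (2 * n).+1))//=; last lia.
suff : wt n / 4 <= \sum_(n.+1 <= j < (2 * n).+1) p j by lra.
rewrite (_ : wt n / 4 = \sum_(n.+1 <= j < (2 * n).+1) (wt n / (4 * n%:R))); last first.
  rewrite sumr_const_nat (_ : ((2 * n).+1 - n.+1)%N = n); last lia.
  by rewrite -mulr_natl; field; rewrite pnatr_eq0 -lt0n.
apply: ler_sum_nat => j /andP[nj jn].
have [||lj ln l1 l2] := HN j n; [lia|lia|].
rewrite p_wt; last lia.
have n0' : 0 < n%:R :> R by rewrite ltr0n.
have j0' : 0 < j%:R :> R by rewrite ltr0n; lia.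
rewrite ler_pdivlMr// mulrAC ler_pdivrMr ?mulr_gt0//.
have : j%:R <= 2 * n%:R :> R by rewrite -natrM ler_nat; lia.
nra.
Qed.

(** Every dyadic block contributes a fixed fraction of its weight to the tail, and consecutive
    blocks have nearly equal weights; [T] blocks give [T / 8 * wt n], with [T] arbitrary. *)
Lemma wt_small (e : R) : 0 < e -> exists N, forall n, (N <= n)%N -> wt n <= e * tail n.
Proof.
have key T : exists N, forall n, (N <= n)%N -> T%:R / 8 * wt n <= tail n.
  elim: T => [|T [N IH]].
    by exists 0%N => n _; rewrite !mul0r tail_ge0.
  (* With this tolerance [T * wt (2n) >= (T - 1) * wt n]: the new block's 1/4 covers the loss of 1/8
     and still gains 1/8. *)
  have T1 : 0 < T.+1%:R^-1 :> R by rewrite invr_gt0 ltr0n.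
  have [N1 H1] := win _ T1; have [N2 H2] := tail_dyadic.
  exists (N + N1 + N2)%N => n Nn.
  have h2 : wt n / 4 + tail (2 * n)%N <= tail n by apply: H2; lia.
  have h3 : T%:R / 8 * wt (2 * n)%N <= tail (2 * n)%N by apply: IH; lia.
  have [||l2n ln l2 _] := H1 (2 * n)%N n; [lia|lia|].
  rewrite -natr1 in l2 *; set t : R := T%:R in h3 l2 *.
  have t0 : 0 <= t by rewrite ler0n.
  have t1 : 0 < t + 1 by lra.
  set x := wt _ in h3 l2; set y := wt n in h2 l2 ln *.
  have yx : (t + 1) * y <= (t + 2) * x.
    rewrite -ler_pdivlMl// (le_trans l2)// [leRHS](_ : _ = (1 + (t + 1)^-1) * x)//; field; lra.
  have : (t - 1) * y <= t * x.
    rewrite -(@ler_pM2l _ (t + 2)); last lra.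
    have : t * ((t + 1) * y) <= t * ((t + 2) * x) by rewrite ler_wpM2l.
    nra.
  lra.
move=> e0; have [N HN] := key (Num.truncn (8 / e)).+1.
exists N => n /HN h.
apply: (@le_trans _ _ (e * ((Num.truncn (8 / e)).+1%:R / 8 * wt n))); last by rewrite ler_wpM2l// ltW.
move: (wt_ge0 n) => w0.
have : 8 / e <= (Num.truncn (8 / e)).+1%:R by apply: ltW; exact: truncnS_gt.
set k := (_.+1%:R); rewrite ler_pdivrMr// => ek.
nra.
Qed.

(* Monotone by construction, and of the order of [sqrt n * wt n] by [potter_bound]:
   this replaces Potter's bounds with exponent 1/2. *)
Definition potter n := \big[Num.max/0]_(j < n.+1) (Num.sqrt j%:R * wt j).

Lemma potter_ub j n : (j <= n)%N -> Num.sqrt j%:R * wt j <= potter n.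
Proof.
move=> jn; have jn1 : (j < n.+1)%N by [].
exact: (le_bigmax _ (fun i : 'I_n.+1 => Num.sqrt i%:R * wt i) (Ordinal jn1)).
Qed.

Lemma potter_le n (c : R) : 0 <= c ->
  (forall j, (j <= n)%N -> Num.sqrt j%:R * wt j <= c) -> potter n <= c.
Proof. by move=> c0 H; apply/bigmax_leP; split => // i _; apply: H; rewrite -ltnS. Qed.

Lemma potter_ge0 n : 0 <= potter n.
Proof. by rewrite (le_trans _ (@potter_ub 0%N n _))// mulr_ge0// wt_ge0. Qed.

Lemma potter_mono m n : (m <= n)%N -> potter m <= potter n.
Proof.
move=> mn; apply: potter_le; first exact: potter_ge0.
by move=> j jm; apply: potter_ub; exact: leq_trans mn.
Qed.

(** With [g n = sqrt n * wt n], one has [g j <= 2 * g n] within a factor of two, and passing to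
    [uphalf n] does not increase [g]. Repeated halving compares all large [j] with [n]; the finitely
    many small [j] go into the constant. *)
Lemma potter_bound : exists C N, 0 < C /\ forall n, (N <= n)%N ->
  0 < wt n /\ potter n <= C * (Num.sqrt n%:R * wt n).
Proof.
have e0 : 0 < 10^-1 :> R by rewrite invr_gt0.
have [N1 H1] := win _ e0.
(* From [n >= 5] on, [uphalf n <= 6 * n / 10], whose root is at most 9/10 of [sqrt n]; with the
   window tolerance 1/10 this leaves a factor 99/100. *)
pose m1 := (N1 + 5)%N; pose g n := Num.sqrt n%:R * wt n.
have g_ge0 n : 0 <= g n by rewrite mulr_ge0// wt_ge0.
have ga n j : (m1 <= n)%N -> (j <= n <= 2 * j)%N -> g j <= 2 * g n.
  move=> mn jn; have [|_ _ h _] := H1 n j _ jn; first by rewrite /m1 in mn; lia.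
  have s : Num.sqrt j%:R <= Num.sqrt n%:R :> R by rewrite ler_sqrt// ler_nat; lia.
  apply: (@le_trans _ _ (Num.sqrt n%:R * ((1 + 10^-1) * wt n))).
    by apply: ler_pM => //; exact: wt_ge0.
  have := g_ge0 n; rewrite /g; lra.
have gb n : (m1 <= n)%N -> g (uphalf n) <= g n.
  move=> mn; have [||_ _ h _] := H1 n (uphalf n); rewrite /m1 in mn; [lia|lia|].
  have s : Num.sqrt (uphalf n)%:R <= 9 / 10 * Num.sqrt n%:R :> R.
    rewrite -[9 / 10]ger0_norm; last lra.
    rewrite -sqrtr_sqr -sqrtrM ?sqr_ge0// ler_sqrt; last by rewrite mulr_ge0// sqr_ge0.
    have : (10 * uphalf n)%:R <= (6 * n)%:R :> R by rewrite ler_nat; lia.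
    have : 0 <= n%:R :> R by [].
    rewrite !natrM; lra.
  apply: (@le_trans _ _ (9 / 10 * Num.sqrt n%:R * ((1 + 10^-1) * wt n))).
    by apply: ler_pM => //; exact: wt_ge0.
  have := g_ge0 n; rewrite /g; lra.
have gc n j : (m1 <= j <= n)%N -> g j <= 2 * g n.
  elim/ltn_ind: n j => n IH j /andP[mj jn].
  have [nj|nj] := leqP n (2 * j)%N; first by apply: ga; lia.
  apply: (@le_trans _ _ (2 * g (uphalf n))); first by apply: IH; rewrite /m1 in mj; lia.
  by rewrite ler_wpM2l//; apply: gb; lia.
have w1 : 0 < wt m1 by have [||//] := H1 m1 m1; rewrite /m1; lia.
have g1 : 0 < g m1 by rewrite mulr_gt0// sqrtr_gt0 ltr0n /m1 addn_gt0 orbT.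
(* The second summand serves [j < m1], where [g j <= potter m1] and [g m1 <= 2 * g n]. *)
pose C := 2 + 2 * potter m1 / g m1.
have C2 : 2 <= C by rewrite lerDl divr_ge0// ?mulr_ge0// ?potter_ge0// ltW.
exists C, m1; split; first lra.
move=> n mn; split; first by have [||//] := H1 n n; rewrite /m1 in mn; lia.
rewrite -/(g n); apply: potter_le; first by rewrite mulr_ge0//; lra.
move=> j jn; rewrite -/(g j).
have [mj|jm] := leqP m1 j.
  by apply: (@le_trans _ _ (2 * g n)); [apply: gc; rewrite mj|rewrite ler_wpM2r].
apply: (@le_trans _ _ (potter m1)); first by apply: potter_ub; exact: ltnW.
have h : g m1 <= 2 * g n by apply: gc; rewrite leqnn.
apply: (@le_trans _ _ (potter m1 / g m1 * (2 * g n))).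
  rewrite mulrAC ler_pdivlMr//; rewrite ler_wpM2l//; exact: potter_ge0.
rewrite /C; have := g_ge0 n; lra.
Qed.

(** For large [n], combine [potter_bound] with [wt_small]. Below the threshold [N] the tail is at
    least [tail N > 0], which gives the second part of the constant. *)
Lemma potter_tail : exists2 H : R, 0 < H & forall n, potter n <= H * (Num.sqrt n%:R * tail n).
Proof.
have [C [N1 [C0 HC]]] := potter_bound; have [N2 H2] := wt_small _ ltr01.
pose N := (N1 + N2)%N.
have c0 : 0 <= potter N / tail N by rewrite divr_ge0 ?potter_ge0 ?tail_ge0.
exists (C + potter N / tail N); first by rewrite ltr_pwDl.
move=> n; rewrite mulrDl.
have st0 : 0 <= Num.sqrt n%:R * tail n by rewrite mulr_ge0// tail_ge0.
have [Nn|nN] := leqP N n.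
  apply: ler_wpDr; first by rewrite mulr_ge0.
  have [|_ h] := HC n; first by rewrite /N in Nn; lia.
  apply: (le_trans h); rewrite ler_wpM2l//; first exact: ltW.
  by rewrite ler_wpM2l// -[leRHS]mul1r; apply: H2; rewrite /N in Nn; lia.
apply: ler_wpDl; first by rewrite mulr_ge0// ltW.
have [->|n0] := posnP n.
  apply: potter_le => [|j]; first by rewrite sqrtr0 mul0r mulr0.
  by rewrite leqn0 => /eqP->; rewrite sqrtr0 !mul0r mulr0.
apply: (@le_trans _ _ (potter N)); first by apply: potter_mono; exact: ltnW.
rewrite mulrAC ler_pdivlMr ?tail_gt0// ler_wpM2l ?potter_ge0//.
apply: (@le_trans _ _ (tail n)); first by apply: tail_mono; exact: ltnW.
rewrite ler_peMl ?tail_ge0//.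
by rewrite -[leLHS]sqrtr1 ler_sqrt// ler1n.
Qed.

(* For [m <= n], the coefficient of ['X^m] in [genp n ^+ k] is the probability that
   [k] independent variables with mass function [p] sum to [m]. *)
Definition genp n : {poly R} := \poly_(j < n.+1) p j.

Lemma coef_genp n j : (j <= n)%N -> (genp n)`_j = p j.
Proof. by move=> jn; rewrite coef_poly ltnS jn. Qed.

Lemma genp_ge0 n : nonneg_poly R (genp n).
Proof. by move=> i; rewrite coef_poly; case: ifP. Qed.

(** A sum at most [m] forces every summand to be at most [m]; then use
    [1 - tail m <= exp (- tail m)]. *)
Lemma genp_psumX m n k : (m <= n)%N ->
  \sum_(i < m.+1) (genp n ^+ k)`_i <= expR (- (k%:R * tail m)).
Proof.
move=> mn; apply: (le_trans (psum_coefX _ _ _ _ (genp_ge0 n))).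
rewrite -mulrN expRM_natl lerXn2r ?nnegrE ?expR_ge0//; first by rewrite sumr_ge0// => i _; exact: genp_ge0.
rewrite (eq_bigr (fun i : 'I_m.+1 => p i)); last first.
  by move=> i _; rewrite coef_genp// (leq_trans _ mn)// -ltnS.
by have := expR_ge1Dx (- tail m); rewrite /tail; lra.
Qed.

Lemma wt_le_potter m j : (0 < j <= m)%N -> wt j <= potter m / Num.sqrt j%:R.
Proof.
move=> /andP[j0 jm]; rewrite ler_pdivlMr ?sqrtr_gt0 ?ltr0n//.
by rewrite mulrC potter_ub.
Qed.

Lemma psum_wt m : \sum_(j < m.+1) wt j <= 2 * potter m * Num.sqrt m%:R.
Proof.
rewrite big_ord_recl /wt mul0r add0r.
apply: (@le_trans _ _ (\sum_(j < m) potter m * (Num.sqrt j.+1%:R)^-1)).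
  by apply: ler_sum => j _; apply: wt_le_potter; rewrite lift0 /=.
rewrite -mulr_sumr [2 * _]mulrC -mulrA ler_wpM2l ?potter_ge0//.
exact: psum_inv_sqrt.
Qed.

(** Indices whose root is at least [c] drop out one by one, until [psum_wt] applies with
    [sqrt m < c]. *)
Lemma psum_wt_lt m n (c : R) : 0 <= c -> (m <= n)%N ->
  \sum_(j < m.+1 | Num.sqrt (j : nat)%:R < c) wt j <= 2 * potter n * c.
Proof.
move=> c0; elim: m => [|m IH] mn.
  rewrite big1 ?mulr_ge0 ?potter_ge0// => i _.
  by rewrite /wt (_ : (i : nat) = 0%N) ?mul0r// ord1.
have [h|h] := ltP (Num.sqrt m.+1%:R) c; last first.
  rewrite big_mkcond big_ord_recr /= ltNge h /= addr0 -big_mkcond.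
  by apply: IH; exact: ltnW.
apply: (@le_trans _ _ (\sum_(j < m.+2) wt j)).
  by rewrite big_mkcond ler_sum// => j _; case: ifP => // _; exact: wt_ge0.
apply: (le_trans (psum_wt _)); rewrite -!mulrA ler_wpM2l//.
by apply: ler_pM; [exact: potter_ge0|exact: sqrtr_ge0|exact: potter_mono|exact: ltW].
Qed.

(* The summands of the size-biased recursion with [sqrt j * e < sqrt m], where [e]
   grows with [k], are handled by induction on [k], the others by [potter]. *)
Lemma coef_genpX_le : exists2 D : R, 0 < D & forall n k m, (0 < m <= n)%N ->
  (genp n ^+ k)`_m <= D * k%:R * (potter m / (m%:R * Num.sqrt m%:R)) *
                      expR (- (k%:R * tail m / 2)).
Proof.
have [H H0 HP] := potter_tail.
pose E : R := expR 1.
have E1 : 1 <= E by rewrite -expR0 ler_expR.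
have E0 : 0 <= E by rewrite expR_ge0.
(* Half of [D] has to dominate [E * (2 + 16 * E * H * x) * exp (- x / 2)], where
   [x * exp (- x / 2) <= 2]. *)
pose D := 2 * E * (2 + 32 * E * H).
have D0 : 0 < D by rewrite !mulr_gt0//; nra.
have DE : D = 2 * E * (2 + 32 * E * H) by [].
clearbody D.
exists D => // n; elim=> [|k IH] m /andP[m0 mn].
  by rewrite expr0 coef1 -[(m == 0)%N]negbK -lt0n m0 /= mulr0 !mul0r.
set t := tail m; set G := potter m; set s := Num.sqrt m%:R : R.
have t0 : 0 <= t by exact: tail_ge0.
have t1 : t <= 1 by exact: tail_le1.
have G0 : 0 <= G by exact: potter_ge0.
have m0' : 0 < m%:R :> R by rewrite ltr0n.
have s0 : 0 < s by rewrite sqrtr_gt0.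
have s2 : s * s = m%:R by rewrite -expr2 sqr_sqrtr// ltW.
pose y := k.+1%:R * G / s; pose x := k.+1%:R * t.
have x0 : 0 <= x by rewrite mulr_ge0.
have y0 : 0 <= y by rewrite !mulr_ge0// invr_ge0 ltW.
have yx : y <= H * x.
  rewrite /y ler_pdivrMr// [leRHS](_ : _ = k.+1%:R * (H * (s * t))); last by rewrite /x; ring.
  by rewrite ler_wpM2l//; exact: HP.
(* The [2] gives [4 * j <= m] for the small indices; [16 * E * y] makes the induction term at most
   half of the target, and [y <= H * x] limits the cost on the large indices. *)
pose e := 2 + 16 * E * y.
have e2 : 2 <= e.
  by have : 0 <= E * y; [exact: mulr_ge0|rewrite /e; lra].
have e0 : 0 < e by lra.
have eE : e = 2 + 16 * E * y by [].
clearbody e.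
(* Replacing [k] by [k.+1] in the exponent costs at most [E], since [t <= 1]. *)
have recx : expR (- (k%:R * t)) <= E * expR (- x).
  by rewrite -expRD ler_expR /x -(@natr1 _ k); lra.
have recx2 : expR (- (k%:R * t / 2)) <= E * expR (- (x / 2)).
  by rewrite -expRD ler_expR /x -(@natr1 _ k); lra.
have key : \sum_(j < m.+1) (j%:R * (genp n)`_j) * (genp n ^+ k)`_(m - j) <=
    G * e / s * expR (- (k%:R * t)) +
    D * k%:R * (4 * (G / (m%:R * s))) * expR (- (k%:R * t / 2)) * (2 * G * (s / e)).
  rewrite (bigID (fun j : 'I_m.+1 => Num.sqrt (j : nat)%:R < s / e)) /= addrC.
  have wtE (j : 'I_m.+1) : j%:R * (genp n)`_j = wt j.
    by rewrite coef_genp// (leq_trans _ mn)// -ltnS.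
  apply: lerD.
    apply: (@le_trans _ _ (\sum_(j < m.+1) G * e / s * (genp n ^+ k)`_(m - j))); last first.
      rewrite -mulr_sumr; apply: ler_wpM2l.
        by rewrite !mulr_ge0 ?invr_ge0//; exact: ltW.
      rewrite (reindex_inj rev_ord_inj) /=.
      under eq_bigr => i _ do rewrite subSS subKn -1?ltnS//.
      exact: genp_psumX.
    rewrite big_mkcond /=; apply: ler_sum => j _; case: ifP => [|_]; last first.
      by rewrite mulr_ge0 ?nonneg_polyX//; [rewrite !mulr_ge0 ?invr_ge0//; exact: ltW|exact: genp_ge0].
    rewrite -leNgt wtE => js; apply: ler_wpM2r; first by apply: nonneg_polyX; exact: genp_ge0.
    have sj0 : 0 < Num.sqrt (j : nat)%:R :> R by apply: lt_le_trans js; rewrite divr_gt0.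
    have j0 : (0 < j)%N by move: sj0; rewrite sqrtr_gt0 ltr0n.
    apply: (le_trans (wt_le_potter m j _)); first by rewrite j0 -ltnS /=.
    rewrite -/G -mulrA ler_wpM2l// -[leRHS]invrK invf_div lef_pV2// posrE divr_gt0//.
  pose c2 := D * k%:R * (4 * (G / (m%:R * s))) * expR (- (k%:R * t / 2)).
  have c20 : 0 <= c2.
    by rewrite !mulr_ge0 ?invr_ge0 ?mulr_ge0 ?expR_ge0//; exact: ltW.
  rewrite -/c2; apply: (@le_trans _ _ (\sum_(j < m.+1 | Num.sqrt (j : nat)%:R < s / e) c2 * wt j)); last first.
    rewrite -mulr_sumr ler_wpM2l//; apply: psum_wt_lt => //.
    by rewrite divr_ge0// ltW.
  apply: ler_sum => j js; rewrite wtE mulrC ler_wpM2r ?wt_ge0//.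
  have j4 : (4 * j <= m)%N.
    rewrite -(ler_nat R) natrM -s2.
    have h : Num.sqrt (j : nat)%:R * 2 <= s.
      by apply: (@le_trans _ _ (Num.sqrt (j : nat)%:R * e)); [rewrite ler_wpM2l|rewrite -ler_pdivlMr// ltW].
    have : Num.sqrt (j : nat)%:R * Num.sqrt (j : nat)%:R = (j : nat)%:R :> R.
      by rewrite -expr2 sqr_sqrtr.
    have := sqrtr_ge0 ((j : nat)%:R : R); nra.
  have mj0 : (0 < m - j <= n)%N by move: j4 m0 mn; clear; lia.
  have mj1 : (m <= 2 * (m - j))%N /\ (m <= 4 * (m - j))%N by move: j4; clear; lia.
  apply: (le_trans (IH _ mj0)).
  have mj : 0 < (m - j)%:R :> R by rewrite ltr0n; case/andP: mj0.
  apply: ler_pM.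
  - by rewrite !mulr_ge0 ?invr_ge0 ?mulr_ge0 ?potter_ge0//; exact: ltW.
  - exact: expR_ge0.
  - apply: ler_wpM2l; first by rewrite mulr_ge0// ltW.
    apply: (@le_trans _ _ (G / ((m - j)%:R * Num.sqrt (m - j)%:R))).
      by rewrite ler_wpM2r ?invr_ge0 ?mulr_ge0//; apply: potter_mono; exact: leq_subr.
    rewrite mulrCA ler_wpM2l// -[4]invrK -invfM lef_pV2 ?posrE ?mulr_gt0 ?sqrtr_gt0//.
    have h1 : m%:R <= 2 * (m - j)%:R :> R by rewrite -natrM ler_nat; case: mj1.
    have h2 : s <= 2 * Num.sqrt (m - j)%:R.
      rewrite -[2]ger0_norm// -sqrtr_sqr -sqrtrM ?sqr_ge0// ler_sqrt; last by rewrite mulr_ge0// sqr_ge0.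
      have : m%:R <= 4 * (m - j)%:R :> R by rewrite -natrM ler_nat; case: mj1.
      lra.
    have := sqrtr_ge0 ((m - j)%:R : R); nra.
  - rewrite ler_expR lerN2 ler_wpM2r ?invr_ge0// ler_wpM2l//.
    by apply: tail_mono; exact: leq_subr.
pose z := expR (- (x / 2)).
have z0 : 0 < z by exact: expR_gt0.
have xz : x * z <= 2.
  have : (1 + x / 2) * z <= expR (x / 2) * z by rewrite ler_wpM2r ?expR_ge0// expR_ge1Dx.
  by rewrite expRxMexpNx_1; nra.
have zz : expR (- x) = z * z by rewrite -expRD; congr expR; lra.
have Gs : 0 <= G / s by rewrite divr_ge0// ltW.
rewrite -(ler_pM2l m0') coef_expS_deriv.
rewrite (_ : m%:R * _ = k.+1%:R * (D * (G / s) * z)); last first.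
  rewrite -/x (_ : m%:R * _ = (m%:R / m%:R) * (k.+1%:R * (D * (G / s) * z))).
    by rewrite divff ?gt_eqF// mul1r.
  by rewrite invfM -/z; ring.
rewrite ler_wpM2l//; apply: (le_trans key).
rewrite (_ : D * (G / s) * z = D / 2 * (G / s) * z + D / 2 * (G / s) * z); last by field; rewrite gt_eqF.
apply: lerD.
  apply: (@le_trans _ _ (G / s * (E * (e * z) * z))).
    rewrite (_ : G * e / s = G / s * e); last by ring.
    rewrite -mulrA ler_wpM2l//.
    rewrite (_ : E * _ * _ = e * (E * (z * z))); last by ring.
    by rewrite ler_wpM2l ?(ltW e0)// -zz.
  rewrite [leRHS](_ : _ = G / s * (D / 2 * z)); last by ring.
  rewrite ler_wpM2l// ler_wpM2r ?(ltW z0)// DE.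
  rewrite (_ : 2 * E * _ / 2 = E * (2 + 32 * E * H)); last by field.
  rewrite ler_wpM2l//.
  have ex : e * z <= (2 + 16 * E * (H * x)) * z.
    by rewrite ler_wpM2r ?(ltW z0)// eE lerD2l ler_wpM2l// mulr_ge0.
  apply: (le_trans ex).
  have z1 : z <= 1 by rewrite expR_le1; lra.
  have EH : 0 <= E * H by rewrite mulr_ge0// ltW.
  have : E * H * (x * z) <= E * H * 2 by rewrite ler_wpM2l.
  nra.
apply: (@le_trans _ _ (D * (G / s) * (8 * (y / e)) * (E * z))).
  rewrite [leLHS](_ : _ = D * (G / s) * (8 * (k%:R * G / s / e)) * expR (- (k%:R * t / 2))); last first.
    by rewrite -s2; field; rewrite !gt_eqF.
  apply: ler_pM => //; rewrite ?expR_ge0//.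
    by rewrite !mulr_ge0 ?invr_ge0//; exact: ltW.
  apply: ler_wpM2l; first by rewrite !mulr_ge0 ?invr_ge0//; exact: ltW.
  by rewrite ler_wpM2l// ler_wpM2r ?invr_ge0 ?(ltW e0)// /y ler_wpM2r ?invr_ge0 ?(ltW s0)// ler_wpM2r// ler_nat.
rewrite [leLHS](_ : _ = (D * (G / s) * z / 2) * (16 * E * (y / e))); last by field; rewrite !gt_eqF.
rewrite [leRHS](_ : _ = (D * (G / s) * z / 2) * 1); last by ring.
apply: ler_wpM2l; first by rewrite !mulr_ge0 ?invr_ge0//; exact: ltW.
rewrite mulrA ler_pdivrMr// mul1r eE; lra.
Qed.

(** In the size-biased recursion at [n], indices [j >= n / 2] have weight at most [(1 + e) * wt n],
    and the matching coefficients sum to at most [(1 - tail n)^k]. For smaller [j], [coef_genpX_le]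
    bounds the coefficient at [n - j] and [psum_wt] the weights; [potter_bound] turns
    [potter n / sqrt n] into [C * wt n]. *)
Lemma coef_genpX_upper (e : R) : 0 < e -> exists C N, 0 < C /\
  forall n k, (N <= n)%N -> (genp n ^+ k.+1)`_n <=
    (1 + e) * (k.+1%:R * p n) * (1 - tail n) ^+ k +
    C * (k.+1%:R * p n) * (k%:R * wt n) * expR (- (k%:R * tail n / 2)).
Proof.
move=> e0; have [D D0 HD] := coef_genpX_le.
have [C [N1 [C0 HC]]] := potter_bound; have [N2 H2] := win _ e0.
(* The [8] is the 4 from comparing [n - j] with [n], times the 2 of [psum_wt]; [C ^+ 2] comes from
   two factors [potter n]. *)
exists (8 * D * C ^+ 2), (N1 + N2).+1; split; first by rewrite !mulr_gt0// exprn_gt0.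
move=> n k Nn; have [|w0 Gw] := HC n; first by move: Nn; clear; lia.
have n0 : (0 < n)%N by move: Nn; clear; lia.
have n0' : 0 < n%:R :> R by rewrite ltr0n.
have s0 : 0 < Num.sqrt n%:R :> R by rewrite sqrtr_gt0.
have s2 : Num.sqrt n%:R * Num.sqrt n%:R = n%:R :> R by rewrite -expr2 sqr_sqrtr// ltW.
set s := Num.sqrt n%:R : R in Gw s0 s2 *; set G := potter n in Gw *; set t := tail n.
have G0 : 0 <= G by exact: potter_ge0.
have FE : 1 - t = \sum_(i < n.+1) (genp n)`_i.
  rewrite /t /tail opprB addrC subrK; apply: eq_bigr => i _.
  by rewrite coef_genp// -ltnS.
pose X := expR (- (k%:R * t / 2)).
have key : \sum_(j < n.+1) (j%:R * (genp n)`_j) * (genp n ^+ k)`_(n - j) <=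
    (1 + e) * wt n * (1 - t) ^+ k + (D * k%:R * (4 * (G / (n%:R * s))) * X) * (2 * G * s).
  have wtE (j : 'I_n.+1) : j%:R * (genp n)`_j = wt j by rewrite coef_genp// -ltnS.
  have e1 : 0 <= 1 + e by lra.
  rewrite (bigID (fun j : 'I_n.+1 => (n <= 2 * j)%N)) /=.
  apply: lerD.
    apply: (@le_trans _ _ (\sum_(j < n.+1) (1 + e) * wt n * (genp n ^+ k)`_(n - j))); last first.
      rewrite -mulr_sumr; apply: ler_wpM2l; first by rewrite mulr_ge0// wt_ge0.
      rewrite (reindex_inj rev_ord_inj) /= FE.
      under eq_bigr => i _ do rewrite subSS subKn -1?ltnS//.
      by apply: psum_coefX; exact: genp_ge0.
    rewrite big_mkcond /=; apply: ler_sum => j _; case: ifP => [nj|_]; last first.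
      by rewrite mulr_ge0 ?nonneg_polyX//; [rewrite mulr_ge0// wt_ge0|exact: genp_ge0].
    rewrite wtE; apply: ler_wpM2r; first by apply: nonneg_polyX; exact: genp_ge0.
    have jn : (j <= n)%N by rewrite -ltnS.
    have [||//] := H2 n j; first by move: Nn; clear; lia.
    by rewrite jn.
  set c2 := D * k%:R * _ * X.
  have c20 : 0 <= c2.
    by rewrite !mulr_ge0 ?invr_ge0 ?mulr_ge0 ?expR_ge0//; exact: ltW.
  apply: (@le_trans _ _ (\sum_(j < n.+1) c2 * wt j)); last first.
    by rewrite -mulr_sumr ler_wpM2l//; exact: psum_wt.
  rewrite big_mkcond /=; apply: ler_sum => j _; case: ifP => [nj|_]; last first.
    by rewrite mulr_ge0// wt_ge0.
  rewrite wtE mulrC ler_wpM2r ?wt_ge0//.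
  have mj0 : (0 < n - j <= n)%N by move: nj n0; clear; lia.
  have [mj1 mj2] : (n <= 2 * (n - j))%N /\ (n <= 4 * (n - j))%N by move: nj; clear; lia.
  apply: (le_trans (HD _ _ _ mj0)).
  have mj : 0 < (n - j)%:R :> R by rewrite ltr0n; case/andP: mj0.
  apply: ler_pM.
  - by rewrite !mulr_ge0 ?invr_ge0 ?mulr_ge0 ?potter_ge0//; exact: ltW.
  - exact: expR_ge0.
  - apply: ler_wpM2l; first by rewrite mulr_ge0// ltW.
    apply: (@le_trans _ _ (G / ((n - j)%:R * Num.sqrt (n - j)%:R))).
      by rewrite ler_wpM2r ?invr_ge0 ?mulr_ge0//; apply: potter_mono; exact: leq_subr.
    rewrite mulrCA ler_wpM2l// -[4]invrK -invfM lef_pV2 ?posrE ?mulr_gt0 ?sqrtr_gt0//.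
    have h1 : n%:R <= 2 * (n - j)%:R :> R by rewrite -natrM ler_nat.
    have h2 : s <= 2 * Num.sqrt (n - j)%:R.
      rewrite -[2]ger0_norm// -sqrtr_sqr -sqrtrM ?sqr_ge0// ler_sqrt; last by rewrite mulr_ge0// sqr_ge0.
      have : n%:R <= 4 * (n - j)%:R :> R by rewrite -natrM ler_nat.
      lra.
    have := sqrtr_ge0 ((n - j)%:R : R); nra.
  - rewrite ler_expR lerN2 ler_wpM2r ?invr_ge0// ler_wpM2l//.
    by apply: tail_mono; exact: leq_subr.
rewrite -(ler_pM2l n0') coef_expS_deriv.
have np : n%:R * p n = wt n by [].
rewrite [leRHS](_ : _ = k.+1%:R * ((1 + e) * wt n * (1 - t) ^+ k +
    8 * D * C ^+ 2 * wt n * (k%:R * wt n) * X)); last by rewrite -np -/X; ring.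
rewrite ler_wpM2l//; apply: (le_trans key); rewrite lerD2l.
rewrite [leLHS](_ : _ = 8 * D * k%:R * X * (G / s) ^+ 2); last first.
  by rewrite -s2; field; rewrite gt_eqF.
rewrite [leRHS](_ : _ = 8 * D * k%:R * X * (C * wt n) ^+ 2); last by ring.
apply: ler_wpM2l; first by rewrite !mulr_ge0 ?expR_ge0// ltW.
rewrite lerXn2r ?nnegrE// ?divr_ge0 ?mulr_ge0//; [exact: ltW..|].
by rewrite ler_pdivrMr// -mulrA [wt n * _]mulrC.
Qed.

(** For [3 * j <= n] both indices share a window, and replacing the denominator [n] by [n - j] only
    increases the bound. *)
Lemma p_le_shift (e : R) : 0 < e -> exists N, forall n j, (N <= n)%N -> (3 * j <= n)%N ->
  0 < p n /\ p n <= (1 + e) * p (n - j).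
Proof.
move=> e0; have [N HN] := win _ e0; exists N.+1 => n j Nn jn.
have [||w0 w1 _ h] := HN n (n - j)%N; [by move: Nn; clear; lia|by move: jn; clear; lia|].
have [n0 nj0] : (0 < n)%N /\ (0 < n - j)%N by move: Nn jn; clear; lia.
rewrite !p_wt//; split; first by rewrite divr_gt0// ltr0n.
rewrite ler_pdivrMr ?ltr0n// (le_trans h)// -mulrA ler_wpM2l//; first by lra.
rewrite mulrAC ler_pdivlMr ?ltr0n// ler_wpM2l//; first exact: ltW.
by rewrite ler_nat leq_subr.
Qed.

End SlowlyVaryingTail.

(** * Doubling of Laplace transforms *)

Section DoublingSequence.
Context (R : realType) (c : nat -> R).
Hypothesis c_ge0 : forall k, 0 <= c k.
Hypothesis c_dbl : exists K C, forall k, (K <= k)%N ->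
  c (2 * k)%N <= C * c k /\ c (2 * k).+1 <= C * c k.
Hypothesis c_gt0 : exists k, 0 < c k.

Definition laplace (t : R) : \bar R := (\sum_(0 <= k <oo) (c k * expR (- (k%:R * t)))%:E)%E.

Lemma laplace_term_ge0 t k : (0 <= (c k * expR (- (k%:R * t)))%:E)%E.
Proof. by rewrite lee_fin mulr_ge0// expR_ge0. Qed.

Lemma laplace_gt0 t : (0 < laplace t)%E.
Proof.
have [k ck] := c_gt0.
apply: (@lt_le_trans _ _ (c k * expR (- (k%:R * t)))%:E).
  by rewrite lte_fin mulr_gt0// expR_gt0.
rewrite /laplace (nneseriesD1 (n := k))//; last by move=> i _; exact: laplace_term_ge0.
by rewrite leeDl// nneseries_ge0// => i _ _; exact: laplace_term_ge0.
Qed.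

Lemma nneseries_le_bound (u : nat -> \bar R) (B : \bar R) :
  (forall k, (0 <= u k)%E) -> (forall n, (\sum_(0 <= k < n) u k <= B)%E) ->
  (\sum_(0 <= k <oo) u k <= B)%E.
Proof.
move=> u0 uB; apply: lime_le; first by apply: is_cvg_nneseries => *; exact: u0.
by near=> n; exact: uB.
Unshelve. all: by end_near. Qed.

Lemma c_subexp (h : R) : 0 < h -> exists2 M : R, 0 < M & forall k, c k <= M * expR (k%:R * h).
Proof.
move=> h0; have [K [C HC]] := c_dbl.
have C0 : 0 <= `|C| by [].
pose K1 := (2 * K + 2 * (Num.truncn (`|C| / h)).+1)%N.
pose M := 1 + \sum_(j < K1.+1) c j.
have M1 : 1 <= M by rewrite lerDl sumr_ge0.
exists M; first by lra.
elim/ltn_ind => k IH; have [kK|Kk] := leqP k K1.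
  apply: (@le_trans _ _ M).
    rewrite /M (bigD1 (Ordinal (kK : (k < K1.+1)%N)))//= addrCA lerDl addr_ge0// sumr_ge0//.
  rewrite ler_peMr//; first by lra.
  by rewrite -expR0 ler_expR mulr_ge0// ltW.
have k2 : (k = 2 * k./2 \/ k = (2 * k./2).+1)%N by lia.
have ck : c k <= `|C| * c k./2.
  have [|l1 l2] := HC k./2; first by rewrite /K1 in Kk; lia.
  have lC : C * c k./2 <= `|C| * c k./2 by rewrite ler_wpM2r// ler_norm.
  by case: k2 => e; rewrite [X in c X]e; exact: le_trans lC.
have hk : `|C| <= h * (k./2)%:R.
  rewrite mulrC -ler_pdivrMr//; apply: ltW; apply: lt_le_trans (truncnS_gt _) _.
  by rewrite ler_nat; move: Kk; rewrite /K1; move: (Num.truncn _) => q; clear; lia.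
apply: (le_trans ck); apply: (@le_trans _ _ (`|C| * (M * expR ((k./2)%:R * h)))).
  by rewrite ler_wpM2l//; apply: IH; rewrite /K1 in Kk; lia.
rewrite mulrCA ler_wpM2l//; first by lra.
have kk : k./2%:R + k./2%:R <= k%:R :> R by rewrite -natrD ler_nat; lia.
apply: (@le_trans _ _ (expR (k./2%:R * h) * expR (k./2%:R * h))).
  rewrite ler_wpM2r ?expR_ge0//; apply: le_trans (expR_ge1Dx _).
  by rewrite mulrC; lra.
by rewrite -expRD ler_expR -mulrDl ler_wpM2r// ltW.
Qed.

Lemma laplace_fin t : 0 < t -> (laplace t < +oo)%E.
Proof.
move=> t0; have t2 : 0 < t / 2 by rewrite divr_gt0.
have [M M0 HM] := c_subexp _ t2.
pose z := expR (- (t / 2)).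
have z0 : 0 < z by exact: expR_gt0.
have z1 : z < 1 by rewrite expR_lt1; lra.
apply: (@le_lt_trans _ _ (M / (1 - z))%:E); last by rewrite ltry.
apply: nneseries_le_bound => [k|n]; first exact: laplace_term_ge0.
rewrite sumEFin lee_fin.
apply: (@le_trans _ _ (\sum_(0 <= k < n) M * z ^+ k)).
  apply: ler_sum => k _.
  apply: (@le_trans _ _ (M * expR (k%:R * (t / 2)) * expR (- (k%:R * t)))).
    by rewrite ler_wpM2r ?expR_ge0.
  by rewrite -mulrA ler_wpM2l ?(ltW M0)// -expRD -expRM_natl ler_expR; lra.
rewrite -mulr_sumr ler_wpM2l ?(ltW M0)//.
rewrite -[leRHS]mul1r ler_pdivlMr ?subr_gt0// big_mkord.
have := subrX1 z n; have := exprn_ge0 n (ltW z0); nra.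
Qed.

(** Terms [2k] and [2k+1] at [t] are paired against term [k] at [2t]. The pairs with [k < K] total
    at most [2 * B * K], which is paid for by one positive term of the series at [2t]. *)
Lemma laplace_double : exists2 C1 : R, 0 < C1 &
  forall t, 0 < t <= 1 -> (laplace t <= C1%:E * laplace (2 * t))%E.
Proof.
have [K [C HC]] := c_dbl; have [k0 ck0] := c_gt0.
(* As [2 * t <= 2], the term of index [k0] at [2 * t] is at least [d]. *)
pose d := c k0 * expR (- (k0%:R * 2)).
have d0 : 0 < d by rewrite mulr_gt0// expR_gt0.
pose B := \sum_(j < 2 * K) c j.
have B0 : 0 <= B by rewrite sumr_ge0.
have cB j : (j < 2 * K)%N -> c j <= B.
  by move=> jK; rewrite /B (bigD1 (Ordinal jK))//= lerDl sumr_ge0.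
pose C1 := 1 + 2 * `|C| + 2 * B * K%:R / d.
have BKd : 0 <= 2 * B * K%:R / d by rewrite divr_ge0 ?mulr_ge0// ltW.
have nC : 0 <= `|C| by [].
exists C1; first by rewrite /C1; lra.
move=> t /andP[t0 t1].
apply: nneseries_le_bound => [k|n]; first exact: laplace_term_ge0.
pose x k := c k * expR (- (k%:R * t)).
have x0 k : 0 <= x k by rewrite mulr_ge0// expR_ge0.
pose y k := c k * expR (- (k%:R * (2 * t))).
have y0 k : 0 <= y k by rewrite mulr_ge0// expR_ge0.
have yl m : ((\sum_(0 <= k < m) y k)%:E <= laplace (2 * t))%E.
  by rewrite -sumEFin; apply: nneseries_lim_ge => k _ _; exact: laplace_term_ge0.
have dl : (d%:E <= laplace (2 * t))%E.
  apply: le_trans (yl k0.+1); rewrite lee_fin big_nat_recr//= ler_wpDl ?sumr_ge0//.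
  by rewrite ler_wpM2l// ler_expR lerN2 ler_wpM2l//; lra.
have pair m : \sum_(0 <= k < 2 * m) x k = \sum_(0 <= k < m) (x (2 * k)%N + x (2 * k).+1).
  elim: m => [|m IH]; first by rewrite !big_nil.
  by rewrite (_ : (2 * m.+1 = (2 * m).+2)%N); [rewrite !big_nat_recr//= IH addrA|lia].
have term k : x (2 * k)%N + x (2 * k).+1 <= 2 * `|C| * y k + (if (k < K)%N then 2 * B else 0).
  have E1 : expR (- ((2 * k)%:R * t)) = expR (- (k%:R * (2 * t))).
    by rewrite natrM; congr expR; ring.
  have E2 : expR (- ((2 * k).+1%:R * t)) <= expR (- (k%:R * (2 * t))).
    by rewrite -E1 ler_expR lerN2 ler_wpM2r ?ler_nat// ltW.
  have ex0 : 0 < expR (- (k%:R * (2 * t))) by exact: expR_gt0.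
  have ex1 : expR (- (k%:R * (2 * t))) <= 1 by rewrite expR_le1 oppr_le0 !mulr_ge0// ltW.
  have xx a b : c (2 * k)%N <= a -> c (2 * k).+1 <= a -> a <= b -> x (2 * k)%N + x (2 * k).+1 <= 2 * (b * expR (- (k%:R * (2 * t)))).
    move=> ca ca' ab; rewrite mulr_natl mulr2n lerD//.
      by rewrite /x E1 ler_wpM2r ?(ltW ex0)// (le_trans ca).
    by apply: ler_pM (expR_ge0 _) _ E2 => //; exact: le_trans ab.
  case: ifPn => [kK|kK].
    apply: (@le_trans _ _ (2 * (B * expR (- (k%:R * (2 * t)))))).
      by apply: (xx B B) => //; apply: cB; move: kK; clear; lia.
    have : 0 <= `|C| * y k by rewrite mulr_ge0.
    have : B * expR (- (k%:R * (2 * t))) <= B * 1 by rewrite ler_wpM2l.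
    lra.
  rewrite addr0 /y -mulrA [`|C| * _]mulrA.
  have [|l1 l2] := HC k; first by rewrite leqNgt.
  by apply: xx l1 l2 _; rewrite ler_wpM2r// ler_norm.
apply: (@le_trans _ _ (\sum_(0 <= k < n) (2 * `|C| * y k + (if (k < K)%N then 2 * B else 0)))%:E).
  rewrite sumEFin lee_fin; apply: (@le_trans _ _ (\sum_(0 <= k < 2 * n) x k)).
    by rewrite [leRHS](big_cat_nat (n := n))//=; [rewrite lerDl sumr_ge0|lia].
  by rewrite pair; apply: ler_sum => k _; exact: term.
rewrite big_split /= -mulr_sumr.
have B2 m : \sum_(0 <= k < m) (if (k < K)%N then 2 * B else 0) <= 2 * B * K%:R.
  apply: (@le_trans _ _ (2 * B * (minn m K)%:R)); last first.
    by rewrite ler_wpM2l ?mulr_ge0// ler_nat geq_minr.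
  elim: m => [|m IH]; first by rewrite big_nil min0n mulr0.
  rewrite big_nat_recr//=; apply: (le_trans (lerD IH (lexx _))).
  case: ifPn => mK; last by rewrite addr0 ler_wpM2l ?mulr_ge0// ler_nat; move: mK; clear; lia.
  by rewrite (_ : minn m.+1 K = (minn m K).+1); [rewrite -natr1; lra|move: mK; clear; lia].
have t20 : 0 < 2 * t by rewrite mulr_gt0.
have fl : laplace (2 * t) \is a fin_num.
  by rewrite ge0_fin_numE ?laplace_fin// ltW// laplace_gt0.
move: dl (yl n); rewrite -(fineK fl); set l := fine _; rewrite -EFinM !lee_fin => dl {}yl.
have l0 : 0 < l by exact: lt_le_trans dl.
have := B2 n; set S := \sum_(0 <= k < n) (if _ then _ else _) => SB.
have h1 : 2 * B * K%:R <= 2 * B * K%:R / d * l.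
  by rewrite [leRHS]mulrAC ler_pdivlMr// ler_wpM2l// !mulr_ge0.
have h2 : `|C| * \sum_(0 <= k < n) y k <= `|C| * l by rewrite ler_wpM2l.
by rewrite /C1; lra.
Qed.

(** Three doublings. The remainder, once its factor [k] is absorbed, decays like
    [exp (- k * t / 4)], while the main sum is bounded below by the transform at [2 * t]. *)
Lemma laplace_octuple : exists2 C1 : R, 0 < C1 &
  forall t, 0 < t <= 1 -> (laplace (t / 4) <= C1%:E * laplace (2 * t))%E.
Proof.
have [C C0 HC] := laplace_double.
exists (C * (C * C)); first by rewrite !mulr_gt0.
move=> t /andP[t0 t1].
have h1 : (laplace (t / 4) <= C%:E * laplace (t / 2))%E.
  by rewrite (_ : t / 2 = 2 * (t / 4)); [apply: HC; lra|field].
have h2 : (laplace (t / 2) <= C%:E * laplace t)%E.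
  by rewrite (_ : laplace t = laplace (2 * (t / 2))); [apply: HC; lra|congr laplace; field].
have h3 : (laplace t <= C%:E * laplace (2 * t))%E by apply: HC; lra.
apply: (le_trans h1); rewrite EFinM -muleA lee_pmul2l ?lte_fin// ?ltry//.
apply: (le_trans h2); rewrite EFinM -muleA lee_pmul2l ?lte_fin// ?ltry//.
Qed.

End DoublingSequence.

(** * Summation over the number of components *)

Section Core.
Context (R : realType) (p q : nat -> R).
Hypothesis p_ge0 : forall n, 0 <= p n.
Hypothesis p_sum1 : \sum_(j < n) p j @[n --> \oo] --> (1 : R).
Hypothesis win : window R (wt R p).
Let c k : R := k.+1%:R * q k.+1.
Hypothesis q_ge0 : forall k, 0 <= q k.+1.
Hypothesis c_dbl : exists K C, forall k, (K <= k)%N ->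
  c (2 * k)%N <= C * c k /\ c (2 * k).+1 <= C * c k.
Hypothesis c_gt0 : exists k, 0 < c k.

Let c_ge0 k : 0 <= c k. Proof. by rewrite mulr_ge0. Qed.
Let t n := tail R p n.
Let w n := wt R p n.

(** Times [p n], and up to a factor [1 + e], this is the main term of the bound on the sum of
    [q k.+1 * P(S_(k+1) = n)]. *)
Definition abel n : \bar R := (\sum_(0 <= k <oo) (c k * (1 - t n) ^+ k)%:E)%E.

Let t_gt0 n : 0 < t n. Proof. exact: tail_gt0. Qed.
Let t_le1 n : t n <= 1. Proof. exact: tail_le1. Qed.

Lemma tailX_le n k : (1 - t n) ^+ k <= expR (- (k%:R * t n)).
Proof.
rewrite -mulrN expRM_natl lerXn2r ?nnegrE ?expR_ge0 ?subr_ge0//.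
exact: expR_ge1Dx.
Qed.

Lemma abel_fin n : (abel n < +oo)%E.
Proof.
apply: le_lt_trans (laplace_fin R c c_ge0 c_dbl _ (t_gt0 n)).
apply: lee_nneseries => k _ //.
  by rewrite lee_fin mulr_ge0// exprn_ge0// subr_ge0.
by rewrite lee_fin ler_wpM2l// tailX_le.
Qed.

(** For [t <= 1/2], [exp (2t) >= 1 + 2t >= 1 / (1 - t)]. *)
Lemma laplace_le_abel n : t n <= 1 / 2 -> (laplace R c (2 * t n) <= abel n)%E.
Proof.
move=> t2; apply: lee_nneseries => k _ //.
  by rewrite lee_fin mulr_ge0// expR_ge0.
rewrite lee_fin ler_wpM2l// -mulrN expRM_natl lerXn2r ?nnegrE ?expR_ge0 ?subr_ge0//.
have h := expR_ge1Dx (2 * t n).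
rewrite expRN -[leRHS]invrK lef_pV2 ?posrE ?expR_gt0 ?invr_gt0//; last by lra.
apply: le_trans h; rewrite -div1r ler_pdivrMr; last by lra.
have := t_gt0 n; nra.
Qed.

(** Half of the exponential absorbs the factor [k], through [x * exp (- x) <= 1] at
    [x = k * t n / 4]. This leaves [4 * w n / t n], small by [wt_small], times a Laplace transform
    at [t n / 4]. *)
Lemma remainder_small (e : R) : 0 < e -> exists N, forall n, (N <= n)%N ->
  (\sum_(0 <= k <oo) (c k * (k%:R * w n) * expR (- (k%:R * t n / 2)))%:E
     <= e%:E * abel n)%E.
Proof.
move=> e0; have [C C0 HC] := laplace_octuple R c c_ge0 c_dbl c_gt0.
have d0 : 0 < e / (4 * C) by rewrite divr_gt0// mulr_gt0.
have h0 : 0 < 1 / 2 :> R by lra.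
have [N1 H1] := wt_small R p p_ge0 p_sum1 win _ d0.
have [N2 H2] := tail_cvg0 R p p_sum1 _ h0.
exists (N1 + N2)%N => n Nn.
have wn : w n <= e / (4 * C) * t n by apply: H1; lia.
have tn : t n <= 1 / 2 by apply: H2; lia.
have tn0 := t_gt0 n.
apply: (@le_trans _ _ (\sum_(0 <= k <oo) ((e / C)%:E * (c k * expR (- (k%:R * (t n / 4))))%:E))%E).
  apply: lee_nneseries => k _ //.
    by rewrite lee_fin !mulr_ge0 ?expR_ge0//; exact: wt_ge0.
  rewrite -EFinM lee_fin.
  rewrite (_ : expR (- (k%:R * t n / 2)) = expR (- (k%:R * (t n / 4))) * expR (- (k%:R * (t n / 4)))); last first.
    by rewrite -expRD; congr expR; lra.
  set z := expR (- _); set x := k%:R * (t n / 4).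
  have z0 : 0 < z by exact: expR_gt0.
  have xz : x * z <= 1.
    have : (1 + x) * z <= expR x * z by rewrite ler_wpM2r ?expR_ge0// expR_ge1Dx.
    by rewrite expRxMexpNx_1; lra.
  rewrite [leRHS](_ : _ = c k * z * (e / C)); last by ring.
  rewrite [leLHS](_ : _ = c k * z * (k%:R * w n * z)); last by ring.
  rewrite ler_wpM2l//; first by rewrite mulr_ge0// ltW.
  apply: (@le_trans _ _ (k%:R * (e / (4 * C) * t n) * z)).
    by rewrite ler_wpM2r ?(ltW z0)// ler_wpM2l.
  rewrite [leLHS](_ : _ = e / C * (x * z)); last by rewrite /x; field; rewrite gt_eqF.
  by rewrite -[leRHS]mulr1 ler_wpM2l// divr_ge0// ltW.
rewrite nneseriesZl; last by move=> k _; exact: laplace_term_ge0.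
apply: (@le_trans _ _ ((e / C)%:E * (C%:E * laplace R c (2 * t n)))%E).
  rewrite lee_pmul2l// ?lte_fin ?divr_gt0//.
  by apply: HC; rewrite tn0 t_le1.
rewrite muleA -EFinM divfK ?gt_eqF// lee_pmul2l// ?lte_fin//.
exact: laplace_le_abel.
Qed.

(** Gathers what the comparison at a fixed [n] uses: the main sum [A], the remainders [r], the shift
    bound for [p], and a first-moment bound that excludes sequences of sum above [d * n]. *)
Lemma core (e d : R) : 0 < e -> 0 < d -> exists N, forall n, (N <= n)%N ->
  [/\ 0 < p n, 0 < 1 - t n & exists A r,
  [/\ 0 < A, abel n = A%:E,
      forall j, (3 * j <= n)%N -> p n <= (1 + e) * p (n - j),
      [/\ forall k, 0 <= r k, (\sum_(0 <= k <oo) (r k)%:E <= (e * A)%:E)%E &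
        forall k, q k.+1 * (genp R p n ^+ k.+1)`_n <= p n * ((1 + e) * (c k * (1 - t n) ^+ k) + r k)] &
      (\sum_(0 <= k <oo) (c k * (k%:R * (1 - t n) ^+ k.-1 * (\sum_(j < n.+1) w j)))%:E
        <= (e * d * n%:R * A)%:E)%E]].
Proof.
move=> e0 d0.
have [C [N1 [C0 H1]]] := coef_genpX_upper R p p_ge0 p_sum1 win _ e0.
have [N2 H2] := p_le_shift R p win _ e0.
have [C' [N3 [C'0 H3]]] := potter_bound R p p_ge0 win.
have h0 : 0 < 1 / 2 :> R by lra.
have [N4 H4] := tail_cvg0 R p p_sum1 _ h0.
have eC : 0 < e / C by rewrite divr_gt0.
have [N5 H5] := remainder_small _ eC.
pose E : R := expR 1.
have E0 : 0 < E by exact: expR_gt0.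
(* The truncated sum of weights is at most [2 * C' * n * w n], and trading the exponent [k.-1] for
   [k / 2] costs [E]; the denominator compensates both constants. *)
have ed : 0 < e * d / (2 * C' * E) by rewrite divr_gt0 ?mulr_gt0.
have [N6 H6] := remainder_small _ ed.
exists (N1 + N2 + N3 + N4 + N5 + N6).+1 => n Nn.
have n0 : (0 < n)%N by move: Nn; clear; lia.
have [pn _] : 0 < p n /\ p n <= (1 + e) * p (n - 0)%N by apply: H2; move: Nn; clear; lia.
have tn : t n <= 1 / 2 by apply: H4; move: Nn; clear; lia.
split => //; first by lra.
pose A := fine (abel n).
have AE : abel n = A%:E.
  rewrite fineK// ge0_fin_numE ?abel_fin//.
  by apply: nneseries_ge0 => k _ _; rewrite lee_fin mulr_ge0// exprn_ge0// subr_ge0.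
have A0 : 0 < A.
  rewrite -lte_fin -AE; apply: lt_le_trans (laplace_le_abel _ tn).
  exact: laplace_gt0.
exists A, (fun k => C * (c k * (k%:R * w n) * expR (- (k%:R * t n / 2)))); split => //.
- by move=> j jn; apply: (H2 n j _ jn).2; move: Nn; clear; lia.
- split.
  + by move=> k; rewrite !mulr_ge0 ?expR_ge0 ?(ltW C0)//; exact: wt_ge0.
  + under eq_eseriesr do rewrite EFinM.
    rewrite nneseriesZl; last first.
      by move=> k _; rewrite lee_fin !mulr_ge0 ?expR_ge0//; exact: wt_ge0.
    have h : (N5 <= n)%N by move: Nn; clear; lia.
    rewrite [leRHS](_ : _ = (C%:E * ((e / C)%:E * A%:E))%E); last first.
      by rewrite -!EFinM; congr EFin; field; rewrite gt_eqF.
    by rewrite lee_pmul2l// ?lte_fin// -AE; exact: H5.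
  + move=> k; apply: (@le_trans _ _ (q k.+1 * ((1 + e) * (k.+1%:R * p n) * (1 - t n) ^+ k +
    C * (k.+1%:R * p n) * (k%:R * w n) * expR (- (k%:R * t n / 2))))).
      by rewrite ler_wpM2l//; apply: H1; move: Nn; clear; lia.
    by rewrite /c le_eqVlt; apply/orP; left; apply/eqP; ring.
have [|_ Gw] := H3 n; first by move: Nn; clear; lia.
have sw : \sum_(j < n.+1) w j <= 2 * C' * n%:R * w n.
  apply: (le_trans (psum_wt R p p_ge0 n)).
  rewrite -mulrA -[2 * C' * _ * _]mulrA -[2 * C' * _]mulrA ler_wpM2l//.
  apply: (@le_trans _ _ (C' * (Num.sqrt n%:R * wt R p n) * Num.sqrt n%:R)).
    by rewrite ler_wpM2r.
  rewrite [leLHS](_ : _ = C' * ((Num.sqrt n%:R * Num.sqrt n%:R) * wt R p n)); last by ring.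
  by rewrite -expr2 sqr_sqrtr.
have h : (N6 <= n)%N by move: Nn; clear; lia.
have n0' : 0 < n%:R :> R by rewrite ltr0n.
have K0 : 0 < 2 * C' * n%:R * E by rewrite !mulr_gt0.
apply: (@le_trans _ _ (\sum_(0 <= k <oo) ((2 * C' * n%:R * E)%:E * (c k * (k%:R * w n) * expR (- (k%:R * t n / 2)))%:E))%E); last first.
  rewrite nneseriesZl; last first.
    by move=> k _; rewrite lee_fin !mulr_ge0 ?expR_ge0//; exact: wt_ge0.
  rewrite [leRHS](_ : _ = ((2 * C' * n%:R * E)%:E * ((e * d / (2 * C' * E))%:E * A%:E))%E); last first.
    by rewrite -!EFinM; congr EFin; field; rewrite !gt_eqF.
  by rewrite lee_pmul2l// ?lte_fin// -AE; exact: H6.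
have sw0 : 0 <= \sum_(j < n.+1) w j by apply: sumr_ge0 => j _; exact: wt_ge0.
have F0 : 0 <= 1 - t n by rewrite subr_ge0.
apply: lee_nneseries => k _.
  by move=> _; rewrite lee_fin !mulr_ge0 ?exprn_ge0.
rewrite -EFinM lee_fin [leRHS](_ : _ = c k * (k%:R * (E * expR (- (k%:R * t n / 2))) * (2 * C' * n%:R * w n))); last by ring.
rewrite ler_wpM2l//; apply: ler_pM => //; first by rewrite mulr_ge0// exprn_ge0.
(* At [k = 0] the predecessor is truncated to 0, but the factor [k] vanishes. *)
case: k => [|k]; first by rewrite !mul0r.
rewrite ler_wpM2l//= (le_trans (tailX_le _ _))// -expRD ler_expR -(@natr1 _ k).
have := ler0n R k; have := t_gt0 n; have := t_le1 n; nra.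
Qed.

End Core.

(** * Sums over finite sequences *)

Section SumSeq.
Context (n : nat).

(** General values allow sums of polynomials, which [raddf_sumseq] pushes through coefficient
    extraction, evaluation and differentiation. *)
Fixpoint sumseq (V : nmodType) k (g : seq nat -> V) : V :=
  if k is k'.+1 then \sum_(j < n.+1) sumseq V k' (fun s => g ((j : nat) :: s)) else g [::].

Lemma eq_sumseq (V : nmodType) k (g h : seq nat -> V) :
  (forall s, size s = k -> all (fun x => x <= n)%N s -> g s = h s) -> sumseq V k g = sumseq V k h.
Proof.
elim: k g h => [|k IH] g h gh /=; first exact: gh.
apply: eq_bigr => j _; apply: IH => s sk sn; apply: gh => /=; first by rewrite sk.
by rewrite sn andbT -ltnS.
Qed.

Lemma raddf_sumseq (V W : zmodType) (f : {additive V -> W}) k (g : seq nat -> V) :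
  f (sumseq V k g) = sumseq W k (f \o g).
Proof.
elim: k g => [//|k IH] g /=; rewrite raddf_sum; apply: eq_bigr => j _.
exact: IH.
Qed.

Lemma sumseq_mull (A : pzRingType) k a (g : seq nat -> A) :
  sumseq A k (fun s => a * g s) = a * sumseq A k g.
Proof.
elim: k g => [//|k IH] g /=; rewrite mulr_sumr; apply: eq_bigr => j _.
exact: IH.
Qed.

Lemma ler_sumseq (R : numDomainType) k (g h : seq nat -> R) :
  (forall s, g s <= h s) -> sumseq R k g <= sumseq R k h.
Proof.
elim: k g h => [|k IH] g h gh /=; first exact: gh.
by apply: ler_sum => j _; exact: IH.
Qed.

Lemma sumseq0 (V : nmodType) k : sumseq V k (fun=> 0) = 0.
Proof. by elim: k => [//|k IH] /=; rewrite big1. Qed.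

Lemma sumseq_ge0 (R : numDomainType) k (g : seq nat -> R) :
  (forall s, 0 <= g s) -> 0 <= sumseq R k g.
Proof. by move=> g0; rewrite -(sumseq0 R k); exact: ler_sumseq. Qed.

Lemma esum_sumseq (R : realType) k (g : seq nat -> R) : (forall s, 0 <= g s) ->
  (forall s, ~~ all (fun x => x <= n)%N s -> g s = 0) ->
  \esum_(s in [set s | size s = k]) (g s)%:E = (sumseq R k g)%:E.
Proof.
elim: k g => [|k IH] g g0 gn.
  rewrite (_ : [set s | _] = [set [::]]) ?esum_set1 ?lee_fin//.
  by apply/seteqP; split => [s /= /size0nil|s /= ->].
rewrite (_ : [set s | _] = \bigcup_(j in [set: nat]) (cons j @` [set s | size s = k])); last first.
  apply/seteqP; split => [[//|j s] /= [sk]|s [j _ [s' /= <- <-]] //].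
  by exists j => //; exists s.
rewrite esum_bigcupT; last 2 first.
- by apply/trivIsetP => i j _ _ ij; rewrite -subset0 => s [[s1 _ <-] [s2 _ [/eqP]]]; rewrite eq_sym (negbTE ij).
- by move=> s; rewrite lee_fin.
under eq_esum => j _.
  rewrite esum_image; last by move=> s1 s2 _ _ [].
  rewrite IH//; last by move=> s sn; apply: gn; rewrite /= negb_and sn orbT.
  over.
have h0 j : (0 <= (sumseq R k (g \o cons j))%:E)%E by rewrite lee_fin sumseq_ge0 /=.
rewrite -nneseries_esumT// (nneseries_split 0 n.+1)//.
rewrite eseries0 ?adde0; last first.
  move=> j nj _; congr EFin; rewrite (eq_sumseq _ _ _ (fun=> 0)) ?sumseq0// => s _ _.
  by rewrite gn//= negb_and -ltnNge nj.
  by rewrite sumEFin big_mkord.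
by move=> j _; exact: h0.
Qed.

Lemma esum_size_sumseq (R : realType) (g : seq nat -> R) : (forall s, 0 <= g s) ->
  (forall s, ~~ all (fun x => x <= n)%N s -> g s = 0) ->
  \esum_(s in [set: seq nat]) (g s)%:E = (\sum_(0 <= k <oo) (sumseq R k g)%:E)%E.
Proof.
move=> g0 gn.
rewrite (_ : [set: seq nat] = \bigcup_k [set s | size s = k]); last first.
  by apply/seteqP; split => // s _; exists (size s).
rewrite nneseries_sum_bigcup; last 2 first.
- by apply/trivIsetP => i j _ _ ij; rewrite -subset0 => s [/= si sj]; move: ij; rewrite -si -sj eqxx.
- by move=> s; rewrite lee_fin.
by apply: eq_eseriesr => k _; rewrite esum_sumseq.
Qed.

Section GeneratingPolynomial.
Context (R : realType) (p : nat -> R).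

(** The monomial keeps track of the sum of the sequence; the next three lemmas read off a
    coefficient, the value at 1 and the derivative at 1. *)
Lemma sumseq_genpX k : sumseq {poly R} k (fun s => (\prod_(x <- s) p x) *: 'X^(sumn s)) =
  genp R p n ^+ k.
Proof.
elim: k => [|k IH] /=; first by rewrite big_nil scale1r !expr0.
rewrite exprS {1}/genp poly_def mulr_suml; apply: eq_bigr => j _.
rewrite -IH -sumseq_mull; apply: eq_sumseq => s _ _.
by rewrite big_cons exprD -scalerAl -scalerAr scalerA.
Qed.

Lemma sumseq_coef k m :
  sumseq R k (fun s => \prod_(x <- s) p x * (sumn s == m)%:R) = (genp R p n ^+ k)`_m.
Proof.
rewrite -sumseq_genpX -[RHS]/(coefp m _) raddf_sumseq; apply: eq_sumseq => s _ _ /=.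
by rewrite coefZ coefXn eq_sym.
Qed.

Lemma sumseq_prod k :
  sumseq R k (fun s => \prod_(x <- s) p x) = (\sum_(j < n.+1) p j) ^+ k.
Proof.
have -> : \sum_(j < n.+1) p j = (genp R p n).[1].
  by rewrite horner_poly; apply: eq_bigr => j _; rewrite expr1n mulr1.
rewrite -horner_exp -sumseq_genpX -[RHS]/(horner_eval 1 _) raddf_sumseq.
by apply: eq_sumseq => s _ _ /=; rewrite /horner_eval hornerZ hornerXn expr1n mulr1.
Qed.

Lemma sumseq_prod_sumn k :
  sumseq R k (fun s => \prod_(x <- s) p x * (sumn s)%:R) =
  k%:R * (\sum_(j < n.+1) p j) ^+ k.-1 * \sum_(j < n.+1) wt R p j.
Proof.
have -> : \sum_(j < n.+1) p j = (genp R p n).[1].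
  by rewrite horner_poly; apply: eq_bigr => j _; rewrite expr1n mulr1.
have -> : \sum_(j < n.+1) wt R p j = (genp R p n)^`().[1].
  rewrite /genp poly_def raddf_sum /= horner_sum; apply: eq_bigr => j _.
  by rewrite derivZ derivXn hornerZ hornerMn hornerXn expr1n /wt mulrC.
transitivity ((genp R p n ^+ k)^`().[1]); last first.
  by rewrite deriv_exp hornerMn hornerM horner_exp -mulr_natl mulrA mulrAC.
rewrite -sumseq_genpX -[RHS]/((horner_eval 1 \o @deriv R) _) raddf_sumseq.
apply: eq_sumseq => s _ _ /=.
by rewrite /horner_eval derivZ derivXn hornerZ hornerMn hornerXn expr1n.
Qed.

End GeneratingPolynomial.
End SumSeq.

(** * Insertion of a maximum and the operator [tau] *)

Definition insert_at (m : nat) (s : seq nat) (i : nat) := take i s ++ m :: drop i s.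

Lemma leq_sumn x s : x \in s -> (x <= sumn s)%N.
Proof.
elim: s => //= y s IH; rewrite inE => /orP[/eqP->|/IH]; first exact: leq_addr.
by move=> /leq_trans; apply; exact: leq_addl.
Qed.

Section InsertAt.
Context (m : nat) (s : seq nat) (i : nat).
Hypothesis sm : (sumn s < m)%N.
Hypothesis is_ : (i <= size s)%N.

Let ltm x : x \in s -> (x < m)%N.
Proof. by move=> /leq_sumn xs; exact: leq_ltn_trans sm. Qed.

Let notin_take : m \notin take i s.
Proof. by apply/negP => /mem_take /ltm; rewrite ltnn. Qed.

(** The bound on the sum makes [m] larger than every entry of [s], so its first occurrence reveals
    where it was inserted. *)
Lemma index_insert_at : index m (insert_at m s i) = i.
Proof.
by rewrite /insert_at index_cat (negbTE notin_take) /= eqxx addn0 size_take_min; apply/minn_idPl.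
Qed.

Lemma perm_insert_at : perm_eq (insert_at m s i) (m :: s).
Proof. by rewrite /insert_at perm_catC /= perm_cons perm_catC cat_take_drop. Qed.

Lemma bigmax_insert_at : (\max_(x <- insert_at m s i) x)%N = m.
Proof.
rewrite (perm_big _ perm_insert_at) big_cons; apply/maxn_idPl.
by apply/bigmax_leqP_seq => x /ltm /ltnW.
Qed.

Lemma tau_insert_at : tau (insert_at m s i) = s.
Proof.
rewrite /tau bigmax_insert_at index_insert_at /insert_at.
have si : size (take i s) = i by rewrite size_takel.
rewrite take_cat drop_cat si ltnn subnn /= ?take0 cats0.
by rewrite ltnNge leqnSn /= subSnn /= drop0 cat_take_drop.
Qed.

End InsertAt.

Lemma perm_tau s : s != [::] -> perm_eq ((\max_(x <- s) x)%N :: tau s) s.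
Proof.
move=> s0; set M := (\max_(x <- s) x)%N.
have Ms : M \in s.
  rewrite /M; case: s s0 @M => // a s _; rewrite big_cons.
  elim: s a => [|b s IH] a; first by rewrite big_nil maxn0 mem_head.
  rewrite big_cons maxnA; have [ba|ba] := leqP b a.
    by have := IH a; rewrite !inE => /orP[->//|->]; rewrite !orbT.
  by have := IH b; rewrite !inE => /orP[->|->]; rewrite !orbT.
rewrite /tau -/M perm_sym -[X in perm_eq X _](cat_take_drop (index M s)).
have iM : (index M s < size s)%N by rewrite index_mem.
rewrite (drop_nth 0%N iM) nth_index// perm_catC /= perm_cons.
by rewrite perm_catC.
Qed.

Lemma subset_esum (R : realType) (T : choiceType) (I J : set T) (f : T -> \bar R) :
  I `<=` J -> (forall i, J i -> (0 <= f i)%E) -> (\esum_(i in I) f i <= \esum_(i in J) f i)%E.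
Proof.
move=> IJ f0; rewrite (esumID I J)// (setIidr IJ) leeDl// esum_ge0// => i [Ji _].
exact: f0.
Qed.

Lemma esum_ord_cst (R : realType) m (x : R) : 0 <= x ->
  \esum_(i in `I_m) x%:E = (m%:R * x)%:E.
Proof.
move=> x0; rewrite (esum_fset (finite_II m))//.
by rewrite -fsbig_ord sumEFin sumr_const card_ord mulr_natl.
Qed.

Lemma Kord0E s : s != [::] -> Kord 0 s = (\max_(x <- s) x)%N.
Proof.
rewrite /Kord => s0; have P : perm_eq (sort geq s) s by rewrite perm_sort.
rewrite -(perm_big _ P); have := perm_size P.
have : sorted geq (sort geq s) by apply: sort_sorted => x y; exact: leq_total.
case: (sort geq s) => [|x s'] /=; first by move=> _ /esym/size0nil sn; rewrite sn in s0.
move=> xs _; rewrite big_cons; apply/esym/maxn_idPl/bigmax_leqP_seq => y ys _.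
have tr : transitive geq by move=> a b c /= ab bc; exact: leq_trans bc ab.
by have /allP := order_path_min tr xs; apply.
Qed.

(** [tau] deletes exactly one copy of the maximum, so the closeness of [Kord 0 s] to [sumn s] is a
    statement about the sum of [tau s]. *)
Lemma Kord0_tau s : s != [::] -> (Kord 0 s + sumn (tau s) = sumn s)%N.
Proof. by move=> s0; rewrite Kord0E// -(perm_sumn (perm_tau s s0)). Qed.

Lemma Kord1_tau s : s != [::] -> (Kord 1 s <= sumn (tau s))%N.
Proof.
move=> s0; have := Kord0_tau s s0; have P : perm_eq (sort geq s) s by rewrite perm_sort.
rewrite -(perm_sumn P) /Kord; case: (sort geq s) => [|x [|y s']] //=.
by move=> /eqP; rewrite eqn_add2l => /eqP ->; exact: leq_addr.
Qed.

(** * Comparison of the two laws at a fixed size *)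

Section FixedSize.
Context (R : realType) (w v : nat -> R) (rho : R) (n : nat).
Hypothesis w_ge0 : forall m, 0 <= w m.
Hypothesis v_ge0 : forall k, (1 <= k)%N -> 0 <= v k.
Hypothesis rho_gt0 : 0 < rho.
Hypothesis W_gt0 : 0 < fine (Wval w rho).
Hypothesis u_fin : (0 < u_seq w v n < +oo)%E.

Let W := fine (Wval w rho).
Let p := pX w rho.
Let q k := v k * W ^+ k.
Let S k : R := (genp R p n ^+ k)`_n.
(** After the tilt by [rho] and [W], [U] is the sum of [q k * S k] over [k >= 1]; hence [a k] below
    is the probability that [N_n = k+1], as [gibbs_size] shows. *)
Let U : R := rho ^+ n * fine (u_seq w v n).
Let a k := q k.+1 * S k.+1 / U.
Let F : R := \sum_(j < n.+1) p j.
Let pi s : R := \prod_(x <- s) pXcond w rho n x.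

Lemma pX_ge0 m : 0 <= pX w rho m.
Proof. by rewrite /pX !mulr_ge0 ?exprn_ge0 ?invr_ge0// ltW. Qed.

Let U_gt0 : 0 < U.
Proof. by rewrite mulr_gt0 ?exprn_gt0// fine_gt0. Qed.

Let q_ge0 k : 0 <= q k.+1.
Proof. by rewrite mulr_ge0 ?v_ge0// exprn_ge0// ltW. Qed.

Let S_ge0 k : 0 <= S k.
Proof. by apply: nonneg_polyX; apply: genp_ge0; exact: pX_ge0. Qed.

Let a_ge0 k : 0 <= a k.
Proof.
apply: divr_ge0; last exact: ltW.
by apply: mulr_ge0.
Qed.

Lemma prod_pX s : \prod_(x <- s) pX w rho x = \prod_(x <- s) w x * rho ^+ sumn s / W ^+ size s.
Proof.
elim: s => [|x s IH]; first by rewrite !big_nil !expr0 mulr1 divr1.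
by rewrite !big_cons IH /pX /= exprD exprS; rewrite invfM; ring.
Qed.

Lemma prodp_ge0 s : 0 <= \prod_(x <- s) pX w rho x.
Proof. by apply: prodr_ge0 => x _; exact: pX_ge0. Qed.

(** The tilt to [p] and [q] only moves powers of [rho] and [W], which cancel on sequences of sum
    [n]. *)
Lemma gibbsE s : gibbs w v n s =
  if (0 < size s)%N && (sumn s == n) then q (size s) * \prod_(x <- s) pX w rho x / U else 0.
Proof.
rewrite /gibbs; case: ifP => // /andP[_ /eqP sn]; rewrite prod_pX sn /q /U invfM.
have r0 : rho ^+ n != 0 by rewrite expf_neq0 ?gt_eqF.
have W0 : W ^+ size s != 0 by rewrite expf_neq0 ?gt_eqF.
set iu := (fine _)^-1; by field; rewrite r0.
Qed.

Lemma gibbs_ge0 s : 0 <= gibbs w v n s.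
Proof.
rewrite gibbsE; case: ifP => // /andP[s0 _]; case: (size s) s0 => // k _.
apply: divr_ge0; last exact: ltW.
by apply: mulr_ge0 (q_ge0 _) (prodp_ge0 _).
Qed.

(** Expanding the power of [genp] over all choices of exponents recovers the constrained sum that
    defines [wconv]. *)
Lemma wconvE k : wconv w k n = (S k * W ^+ k) / rho ^+ n.
Proof.
have r0 : rho ^+ n != 0 by rewrite expf_neq0 ?gt_eqF.
have W0 : W ^+ k != 0 by rewrite expf_neq0 ?gt_eqF.
rewrite /S (_ : genp R p n ^+ k = \prod_(i < k) \sum_(j < n.+1) p j *: 'X^j); last first.
  by rewrite prodr_const card_ord /genp poly_def.
rewrite bigA_distr_bigA /= coef_sum !mulr_suml /wconv big_mkcond; apply: eq_bigr => f _.
rewrite (_ : \prod_(i < k) _ = (\prod_(i < k) p (f i)) *: 'X^(\sum_(i < k) f i)); last first.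
  rewrite (big_morph (fun i => 'X^i) (exprD 'X) (expr0 'X)) -mul_polyC rmorph_prod -big_split /=.
  by apply: eq_bigr => i _; rewrite mul_polyC.
rewrite coefZ coefXn eq_sym; case: eqP => [fn|_]; last by rewrite mulr0 !mul0r.
rewrite mulr1 /p /pX !big_split /= prodr_const card_ord.
have -> : \prod_(i < k) rho ^+ f i = rho ^+ n.
  by rewrite (congr1 (fun i => rho ^+ i) fn) (big_morph (fun i => rho ^+ i) (exprD rho) (expr0 _)).
by rewrite exprVn -/W mulfVK// mulfK.
Qed.

Let a_sum : (\sum_(0 <= k <oo) (a k)%:E = 1)%E.
Proof.
have [u0 uoo] := andP u_fin.
transitivity (((fine (u_seq w v n))^-1)%:E * u_seq w v n)%E; last first.
  have uf : u_seq w v n \is a fin_num by rewrite ge0_fin_numE// ltW.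
  by rewrite -{2}(fineK uf) -EFinM mulVf// gt_eqF// fine_gt0.
(* The sign of [v 0] is unknown; the value 0 there keeps every term nonnegative, and [u_seq] starts
   at [k = 1]. *)
pose f k := (if k is k'.+1 then (v k * wconv w k n)%:E else 0%E) : \bar R.
have f_ge0 k : (0 <= f k)%E.
  case: k => [//|k]; rewrite lee_fin mulr_ge0 ?v_ge0// wconvE.
  by apply: divr_ge0; [apply: mulr_ge0 => //|]; rewrite exprn_ge0// ltW.
have uE : u_seq w v n = (\sum_(1 <= k <oo) f k)%E.
  rewrite /u_seq; congr (limn _); apply/funext => m; apply: eq_big_nat => k /andP[k0 _].
  by case: k k0.
rewrite [X in (_ * X)%E]uE -nneseries_addn// -nneseriesZl; last by [].
apply: eq_eseriesr => k _; rewrite addn1 -EFinM; congr EFin; rewrite wconvE /a /U /q.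
have r0 : rho ^+ n != 0 by rewrite expf_neq0 ?gt_eqF.
by rewrite invfM; ring.
Qed.

Lemma gibbs_size k : gibbs_prob w v n [set s | size s = k.+1] = (a k)%:E.
Proof.
rewrite /gibbs_prob (eq_esum (b := fun s => (q k.+1 / U * (\prod_(x <- s) p x * (sumn s == n)%:R))%:E)); last first.
  move=> s /= sk; rewrite gibbsE sk /=; case: eqP => _; congr EFin; last by rewrite !mulr0.
  by rewrite mulr1 mulrAC.
rewrite (esum_sumseq n).
- rewrite sumseq_mull sumseq_coef /a; congr EFin; rewrite -/(S k.+1); ring.
- move=> s; apply: mulr_ge0; first by apply: divr_ge0 (q_ge0 _) (ltW U_gt0).
  exact: mulr_ge0 (prodp_ge0 _) _.
- move=> s /allPn[x xs xn]; case: eqP => sn; last by rewrite !mulr0.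
  by move: xn; rewrite -sn leq_sumn.
Qed.

Lemma gibbs_size0 : gibbs_prob w v n [set s | size s = 0%N] = 0%E.
Proof. by rewrite /gibbs_prob esum1// => s /= s0; rewrite /gibbs s0. Qed.

Lemma gibbs_total : gibbs_prob w v n [set: seq nat] = 1%E.
Proof.
rewrite -a_sum /gibbs_prob (_ : [set: seq nat] = \bigcup_k [set s | size s = k]); last first.
  by apply/seteqP; split => // s _; exists (size s).
rewrite nneseries_sum_bigcup; last 2 first.
- by apply/trivIsetP => i j _ _ ij; rewrite -subset0 => s [/= si sj]; move: ij; rewrite -si -sj eqxx.
- by move=> s; rewrite lee_fin gibbs_ge0.
rewrite nneseries_recl//; last first.
  by move=> k _; apply: esum_ge0 => s _; rewrite lee_fin gibbs_ge0.
rewrite [X in (X + _)%E]gibbs_size0 add0e -nneseries_addn; last first.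
  by move=> k; apply: esum_ge0 => s _; rewrite lee_fin gibbs_ge0.
by apply: eq_eseriesr => k _; rewrite addn1; exact: gibbs_size.
Qed.

Lemma xtildeE s : xtilde_pmf w v rho n s = (a (size s) * pi s)%:E.
Proof. by rewrite /xtilde_pmf gibbs_size EFinM. Qed.

Hypothesis F_gt0 : 0 < F.

Lemma pi_ge0 s : 0 <= pi s.
Proof.
apply: prodr_ge0 => x _; rewrite /pXcond; case: ifP => // _.
by apply: divr_ge0 (pX_ge0 _) (ltW F_gt0).
Qed.

Lemma pi_out s : ~~ all (fun x => x <= n)%N s -> pi s = 0.
Proof.
move=> /allPn[x xs /= xn]; rewrite /pi (perm_big _ (perm_to_rem xs)) big_cons.
by rewrite {1}/pXcond (negbTE xn) /= mul0r.
Qed.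

Lemma pi_in s : all (fun x => x <= n)%N s -> pi s = \prod_(x <- s) p x / F ^+ size s.
Proof.
elim: s => [|x s IH] /=; first by rewrite /pi !big_nil divr1.
move=> /andP[xn sn]; rewrite /pi !big_cons -/(pi s) IH// /pXcond xn exprS invfM.
by rewrite mulrACA.
Qed.

(** [pi] is a probability on the sequences of each given length, as the power of [F] cancels. *)
Lemma pi_total (X : nat -> R) : (forall k, 0 <= X k) ->
  \esum_(s in [set: seq nat]) (X (size s) * pi s)%:E = (\sum_(0 <= k <oo) (X k)%:E)%E.
Proof.
move=> X0; rewrite (esum_size_sumseq n).
- apply: eq_eseriesr => k _; congr EFin.
  rewrite (eq_sumseq n R k _ (fun s => X k / F ^+ k * \prod_(x <- s) p x)).
    by rewrite sumseq_mull sumseq_prod -/F divfK// expf_neq0// gt_eqF.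
  by move=> s sk sn; rewrite sk pi_in// sk; ring.
- by move=> s; exact: mulr_ge0 (X0 _) (pi_ge0 _).
- by move=> s sn; rewrite pi_out// mulr0.
Qed.

(** Markov's inequality: the indicator of [sumn s > y] is at most [sumn s / y], and
    [sumseq_prod_sumn] evaluates the mean. *)
Lemma pi_markov (X : nat -> R) (y : R) : (forall k, 0 <= X k) -> 0 < y ->
  (\esum_(s in [set s | (y < (sumn s)%:R)%R]) (X (size s) * pi s)%:E <=
   \sum_(0 <= k <oo) (X k / F ^+ k / y * (k%:R * F ^+ k.-1 * \sum_(j < n.+1) wt R p j))%:E)%E.
Proof.
move=> X0 y0.
have Xp0 s : 0 <= X (size s) * pi s by exact: mulr_ge0 (X0 _) (pi_ge0 _).
apply: (@le_trans _ _ (\esum_(s in [set: seq nat]) (X (size s) * pi s * ((sumn s)%:R / y))%:E)%E).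
  rewrite esum_mkcond; apply: le_esum => s _; case: ifPn => [|_].
    rewrite inE /= => ys; rewrite lee_fin ler_peMr// ler_pdivlMr// mul1r; exact: ltW.
  by rewrite lee_fin; apply: mulr_ge0 (Xp0 _) _; rewrite divr_ge0// ltW.
rewrite (esum_size_sumseq n).
- rewrite (eq_eseriesr (g := fun k => (X k / F ^+ k / y * (k%:R * F ^+ k.-1 * \sum_(j < n.+1) wt R p j))%:E))// => k _.
  congr EFin.
  rewrite (eq_sumseq n R k _ (fun s => X k / F ^+ k / y * (\prod_(x <- s) p x * (sumn s)%:R))).
    by rewrite sumseq_mull sumseq_prod_sumn.
  by move=> s sk sn; rewrite sk pi_in// sk; ring.
- by move=> s; apply: mulr_ge0 (Xp0 _) _; rewrite divr_ge0// ltW.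
- by move=> s sn; rewrite pi_out// mulr0 mul0r.
Qed.

(** * One-sided comparison under the bounds provided by [core] *)

Variables (e d A : R) (r : nat -> R).
Hypothesis n_gt0 : (0 < n)%N.
Hypothesis e_gt0 : 0 < e.
Hypothesis e_le : e <= 1 / 2.
Hypothesis d_gt0 : 0 < d.
Hypothesis d_le : d <= 1 / 3.
Hypothesis pn_gt0 : 0 < p n.
Hypothesis p_shift : forall j, (3 * j <= n)%N -> p n <= (1 + e) * p (n - j)%N.

Let X k : R := k.+1%:R * q k.+1 * F ^+ k.
(** Dividing the bound [a_le] by [U] makes [kap * X k] the leading term for [a k]. *)
Let kap : R := p n / U.

Let X_ge0 k : 0 <= X k.
Proof. by apply: mulr_ge0; [exact: mulr_ge0|exact: exprn_ge0 (ltW F_gt0)]. Qed.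

Let kap_gt0 : 0 < kap. Proof. exact: divr_gt0. Qed.

Lemma gibbs_insert s i : (3 * sumn s <= n)%N -> (i <= size s)%N ->
  gibbs w v n (insert_at (n - sumn s) s i) =
  q (size s).+1 * (p (n - sumn s)%N * \prod_(x <- s) p x) / U.
Proof.
move=> sn si; have P := perm_insert_at (n - sumn s)%N s i.
rewrite gibbsE (perm_size P) (perm_sumn P) /= subnK ?eqxx; last by move: sn; clear; lia.
by rewrite (perm_big _ P) big_cons.
Qed.

(** Inserting [n - sumn s] at each of the [size s + 1] positions gives distinct preimages of [s]
    under [tau]. The condition [3 * sumn s <= n] makes the new entry the strict maximum and lets
    [p_shift] bound its probability from below. *)
Lemma tauK_lower (B : set (seq nat)) :
  (\esum_(s in B `&` [set s | (3 * sumn s <= n)%N]) (kap / (1 + e) * X (size s) * pi s)%:E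
   <= law_tauK w v n B)%E.
Proof.
set G := B `&` _; pose ins (z : seq nat * nat) := insert_at (n - sumn z.1)%N z.1 z.2.
pose J (s : seq nat) : set nat := `I_(size s).+1.
have Gm s : G s -> (sumn s < n - sumn s)%N by move=> [_ /=]; move: n_gt0; clear; lia.
have tau_ins z : (G `*`` J) z -> tau (ins z) = z.1.
  by move=> [Gz /= Jz]; apply: tau_insert_at; [exact: Gm|rewrite -ltnS].
have e1 : 0 < 1 + e by exact: addr_gt0.
apply: (@le_trans _ _ (\esum_(s in G) \esum_(i in J s) (gibbs w v n (ins (s, i)))%:E)%E).
  apply: le_esum => s Gs; have [_ /= sn] := Gs.
  rewrite (eq_esum (b := fun=> (q (size s).+1 * (p (n - sumn s)%N * \prod_(x <- s) p x) / U)%:E)); last first.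
    by move=> i Ji; rewrite /ins gibbs_insert//= -ltnS.
  have g0 : 0 <= q (size s).+1 * (p (n - sumn s)%N * \prod_(x <- s) p x) / U.
    apply: divr_ge0 (ltW U_gt0); apply: mulr_ge0 (q_ge0 _) _.
    exact: mulr_ge0 (pX_ge0 _) (prodp_ge0 _).
  rewrite esum_ord_cst// lee_fin pi_in; last first.
    by apply/allP => x /leq_sumn; move: sn; clear; lia.
  have Fk : F ^+ size s != 0 by rewrite expf_neq0// gt_eqF.
  set k := size s; set P := \prod_(x <- s) p x.
  rewrite [leLHS](_ : _ = (k.+1%:R * q k.+1 * P / U) * (p n / (1 + e))); last first.
    by rewrite /kap /X; field; rewrite gt_eqF//= Fk gt_eqF.
  rewrite [leRHS](_ : _ = (k.+1%:R * q k.+1 * P / U) * p (n - sumn s)%N); last by ring.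
  rewrite ler_wpM2l//.
    apply: divr_ge0 (ltW U_gt0); apply: mulr_ge0 (prodp_ge0 _).
    exact: mulr_ge0.
  by rewrite ler_pdivrMr// mulrC p_shift.
rewrite esum_esum; last by move=> s i _ _; rewrite lee_fin gibbs_ge0.
rewrite (eq_esum (b := fun z => (gibbs w v n (ins z))%:E)); last by case.
(* Injectivity: [tau] recovers the sequence, and the index of the inserted entry recovers the
   position. *)
rewrite -(@esum_image R _ _ (G `*`` J) ins (fun t => (gibbs w v n t)%:E)); last first.
  move=> z z' /set_mem Pz /set_mem Pz' zz.
  have z1 : z.1 = z'.1 by rewrite -(tau_ins _ Pz) zz tau_ins.
  have z2 : z.2 = z'.2.
    have [Gz Jz] := Pz; have [Gz' Jz'] := Pz'.
    rewrite -(index_insert_at _ _ z.2 (Gm _ Gz)); last by rewrite -ltnS.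
    rewrite -/(ins z) zz z1 /ins index_insert_at//; exact: Gm.
  by case: z z' z1 z2 {Pz Pz' zz} => [? ?] [? ?] /= -> ->.
apply: subset_esum => [_ [z Pz <-]|t _]; last by rewrite lee_fin gibbs_ge0.
by rewrite /= tau_ins//; case: Pz => -[].
Qed.

Hypothesis A_gt0 : 0 < A.
Hypothesis X_sum : (\sum_(0 <= k <oo) (X k)%:E = A%:E)%E.
Hypothesis r_ge0 : forall k, 0 <= r k.
Hypothesis r_sum : (\sum_(0 <= k <oo) (r k)%:E <= (e * A)%:E)%E.
Hypothesis a_le : forall k, q k.+1 * S k.+1 <= p n * ((1 + e) * X k + r k).
Hypothesis X_mean : (\sum_(0 <= k <oo) (k.+1%:R * q k.+1 *
  (k%:R * F ^+ k.-1 * (\sum_(j < n.+1) wt R p j)))%:E <= (e * d * n%:R * A)%:E)%E.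

Definition far : set (seq nat) := [set s | d * n%:R < (sumn s)%:R].

Lemma pi_scaled (b : R) : 0 <= b ->
  \esum_(s in [set: seq nat]) (b * X (size s) * pi s)%:E = (b * A)%:E.
Proof.
move=> b0; rewrite (pi_total (fun k => b * X k)); last by move=> k; exact: mulr_ge0.
rewrite (eq_eseriesr (g := fun k => (b%:E * (X k)%:E)%E)) => [|k _]; last by rewrite EFinM.
by rewrite nneseriesZl ?X_sum// => k _; rewrite lee_fin.
Qed.

(** [pi_markov] at level [d * n], evaluated by [X_mean] once the powers of [F] cancel. *)
Lemma pi_far (b : R) : 0 <= b ->
  (\esum_(s in far) (b * X (size s) * pi s)%:E <= (b * (e * A))%:E)%E.
Proof.
move=> b0; have n0 : 0 < n%:R :> R by rewrite ltr0n.
have dn : 0 < d * n%:R by exact: mulr_gt0.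
apply: (le_trans (pi_markov (fun k => b * X k) _ _ dn)).
  by move=> k; exact: mulr_ge0.
rewrite (eq_eseriesr (g := fun k => ((b / (d * n%:R))%:E * (k.+1%:R * q k.+1 *
  (k%:R * F ^+ k.-1 * (\sum_(j < n.+1) wt R p j)))%:E)%E)); last first.
  move=> k _; rewrite -EFinM; congr EFin.
  have Fk : F ^+ k != 0 by rewrite expf_neq0// gt_eqF.
  set m1 := \sum_(j < n.+1) _; rewrite /X.
  by field; rewrite Fk !gt_eqF.
have m0 : 0 <= \sum_(j < n.+1) wt R p j.
  by apply: sumr_ge0 => j _; apply: mulr_ge0 => //; exact: pX_ge0.
rewrite nneseriesZl; last first.
  move=> k _; rewrite lee_fin; apply: mulr_ge0; first exact: mulr_ge0.
  by apply: mulr_ge0 m0; apply: mulr_ge0 => //; exact: exprn_ge0 (ltW F_gt0).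
have b0' : (0 <= (b / (d * n%:R))%:E)%E by rewrite lee_fin divr_ge0// ltW.
apply: (le_trans (lee_wpmul2l b0' X_mean)); rewrite -EFinM lee_fin le_eqVlt.
by apply/orP; left; apply/eqP; field; rewrite !gt_eqF.
Qed.

Lemma nfar_sub : ~` far `<=` [set s | (3 * sumn s <= n)%N].
Proof.
move=> s /= /negP; rewrite -leNgt => h.
rewrite -(ler_nat R) natrM; have := ler0n R n; move: h d_le; nra.
Qed.

(** The lower bound off [far] cannot exceed total mass 1, so [kap * A * (1 - e) <= 1 + e]; then use
    [e <= 1/2]. *)
Lemma kapA_le : kap * A <= 3.
Proof.
have e1 : 0 < 1 + e by exact: addr_gt0.
have b0 : 0 <= kap / (1 + e) by apply: divr_ge0 (ltW kap_gt0) (ltW e1).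
have pos s : [set: seq nat] s -> (0 <= (kap / (1 + e) * X (size s) * pi s)%:E)%E.
  move=> _; rewrite lee_fin; apply: mulr_ge0 (pi_ge0 _).
  exact: mulr_ge0.
have := pi_scaled _ b0; rewrite (esumID far)// !setTI => hA.
have h1 : (\esum_(s in ~` far) (kap / (1 + e) * X (size s) * pi s)%:E <= 1%:E)%E.
  apply: (@le_trans _ _ (law_tauK w v n [set: seq nat])).
    apply: le_trans (tauK_lower _); rewrite setTI; apply: subset_esum; first exact: nfar_sub.
    by move=> s _; exact: pos.
  by rewrite /law_tauK preimage_setT gibbs_total.
have := leeD (pi_far _ b0) h1; rewrite hA -EFinD lee_fin.
have -> : kap / (1 + e) * A = kap * A / (1 + e) by ring.
have -> : kap / (1 + e) * (e * A) + 1 = (kap * A * e + (1 + e)) / (1 + e) by field; rewrite gt_eqF.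
rewrite ler_pM2r ?invr_gt0//.
have : 0 < kap * A by exact: mulr_gt0.
move: e_gt0 e_le; nra.
Qed.

(** The term [3 * e] covers the remainders [r], of mass at most [kap * e * A]. *)
Lemma xtilde_le B : (law_xtilde w v rho n B <=
  \esum_(s in B) (kap * (1 + e) * X (size s) * pi s)%:E + (3 * e)%:E)%E.
Proof.
have rp0 s : 0 <= kap * r (size s) * pi s.
  by apply: mulr_ge0 (pi_ge0 _); apply: mulr_ge0 (r_ge0 _); exact: ltW.
have Xp0 s : 0 <= kap * (1 + e) * X (size s) * pi s.
  apply: mulr_ge0 (pi_ge0 _); apply: mulr_ge0 (X_ge0 _); apply: mulr_ge0; first exact: ltW.
  exact: addr_ge0 ler01 (ltW e_gt0).
apply: (@le_trans _ _ (\esum_(s in B) ((kap * (1 + e) * X (size s) * pi s)%:E + (kap * r (size s) * pi s)%:E))%E).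
  apply: le_esum => s _; rewrite xtildeE -EFinD lee_fin -mulrDl ler_wpM2r//; first exact: pi_ge0.
  rewrite /a ler_pdivrMr// (le_trans (a_le _))// /kap le_eqVlt; apply/orP; left; apply/eqP.
  by field; rewrite gt_eqF.
rewrite esumD; [|by move=> s _; rewrite lee_fin..].
rewrite leeD2l//; apply: (@le_trans _ _ (\esum_(s in [set: seq nat]) (kap * r (size s) * pi s)%:E)%E).
  by apply: subset_esum => // s _; rewrite lee_fin.
rewrite (pi_total (fun k => kap * r k)); last by move=> k; apply: mulr_ge0 (r_ge0 _); exact: ltW.
rewrite (eq_eseriesr (g := fun k => (kap%:E * (r k)%:E)%E)) => [|k _]; last by rewrite EFinM.
rewrite nneseriesZl; last by move=> k _; rewrite lee_fin.
have k0 : (0 <= kap%:E)%E by rewrite lee_fin ltW.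
apply: (le_trans (lee_wpmul2l k0 r_sum)); rewrite -EFinM lee_fin.
by have := kapA_le; move: e_gt0; nra.
Qed.

Lemma xtilde_far : (law_xtilde w v rho n far <= (20 * e)%:E)%E.
Proof.
have b0 : 0 <= kap * (1 + e) by apply: mulr_ge0; [exact: ltW|exact: addr_ge0 ler01 (ltW e_gt0)].
apply: (le_trans (xtilde_le _)); apply: (le_trans (leeD (pi_far _ b0) (lexx _))).
rewrite -EFinD lee_fin; have := kapA_le; have : 0 < kap * A by exact: mulr_gt0.
move: e_gt0 e_le; nra.
Qed.

(** Off [far], the bounds of [xtilde_le] and [tauK_lower] differ only in the constants
    [kap * (1 + e)] and [kap / (1 + e)]. That gap, the mass of [far] and the remainders cost at most
    [15/2 * e], [9/2 * e] and [3 * e]. *)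
Lemma xtilde_le_tauK B : (law_xtilde w v rho n B <= law_tauK w v n B + (20 * e)%:E)%E.
Proof.
have e1 : 0 < 1 + e by exact: addr_gt0.
have b0 : 0 <= kap * (1 + e) by apply: mulr_ge0; [exact: ltW|exact: addr_ge0 ler01 (ltW e_gt0)].
have b1 : 0 <= kap / (1 + e) by apply: divr_ge0 (ltW kap_gt0) (ltW e1).
pose b2 := kap * (1 + e) - kap / (1 + e).
have kA := kapA_le; have kA0 : 0 < kap * A by exact: mulr_gt0.
have b2E : b2 = kap * ((2 * e + e ^+ 2) / (1 + e)) by rewrite /b2; field; rewrite gt_eqF.
have b20 : 0 <= b2.
  rewrite b2E; apply: mulr_ge0; first exact: ltW.
  by apply: divr_ge0 (ltW e1); move: e_gt0; nra.
have b2A : b2 * A <= 15 / 2 * e.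
  rewrite b2E mulrAC mulrA ler_pdivrMr// expr2; move: e_gt0 e_le; nra.
have pos b : 0 <= b -> forall s, (0 <= (b * X (size s) * pi s)%:E)%E.
  by move=> b0' s; rewrite lee_fin; apply: mulr_ge0 (pi_ge0 _); exact: mulr_ge0.
apply: (le_trans (xtilde_le _)).
rewrite (esumID far) => [|s _]; last exact: pos.
have h1 : (\esum_(s in B `&` far) (kap * (1 + e) * X (size s) * pi s)%:E <= (kap * (1 + e) * (e * A))%:E)%E.
  apply: le_trans (pi_far _ b0); apply: subset_esum => [|s _]; first exact: subIsetr.
  exact: pos.
have h2 : (\esum_(s in B `&` ~` far) (kap * (1 + e) * X (size s) * pi s)%:E <=
    law_tauK w v n B + (b2 * A)%:E)%E.
  rewrite (eq_esum (b := fun s => ((kap / (1 + e) * X (size s) * pi s)%:E + (b2 * X (size s) * pi s)%:E)%E)); last first.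
    by move=> s _; rewrite -EFinD; congr EFin; rewrite /b2; ring.
  rewrite esumD; [|by move=> s _; exact: pos..].
  apply: leeD.
    apply: le_trans (tauK_lower B); apply: subset_esum => [|s _]; last exact: pos.
    by move=> s [Bs /nfar_sub].
  rewrite -(pi_scaled _ b20); apply: subset_esum => // s _; exact: pos.
apply: (le_trans (leeD (leeD h1 h2) (lexx _))).
rewrite addeCA -addeA leeD2l// -!EFinD lee_fin; move: e_gt0 e_le; nra.
Qed.

Lemma tauK_setC B : (law_tauK w v n B + law_tauK w v n (~` B) = 1)%E.
Proof.
rewrite -gibbs_total /gibbs_prob (esumID (@tau @^-1` B)) ?setTI//.
by move=> s _; rewrite lee_fin gibbs_ge0.
Qed.

Lemma xtilde_pmf_ge0 s : (0 <= xtilde_pmf w v rho n s)%E.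
Proof. by rewrite xtildeE lee_fin; exact: mulr_ge0 (a_ge0 _) (pi_ge0 _). Qed.

Lemma xtilde_setC B : (law_xtilde w v rho n B + law_xtilde w v rho n (~` B) = 1)%E.
Proof.
rewrite -a_sum -(pi_total a)// (eq_esum (b := xtilde_pmf w v rho n)); last first.
  by move=> s _; rewrite xtildeE.
by rewrite (esumID B) ?setTI// => s _; exact: xtilde_pmf_ge0.
Qed.

(** Both laws have mass 1, so the one-sided bound on the complement of [B] gives the other side on
    [B]. *)
Lemma law_dist B : (`|law_tauK w v n B - law_xtilde w v rho n B| <= (20 * e)%:E)%E.
Proof.
have pm C : (0 <= law_tauK w v n C)%E by apply: esum_ge0 => s _; rewrite lee_fin gibbs_ge0.
have pn C : (0 <= law_xtilde w v rho n C)%E by apply: esum_ge0 => s _; exact: xtilde_pmf_ge0.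
have fm C : law_tauK w v n C \is a fin_num.
  rewrite ge0_fin_numE// (@le_lt_trans _ _ 1%E) ?ltry//.
  by rewrite -(tauK_setC C) leeDl.
have fn C : law_xtilde w v rho n C \is a fin_num.
  rewrite ge0_fin_numE// (@le_lt_trans _ _ 1%E) ?ltry//.
  by rewrite -(xtilde_setC C) leeDl.
have xm C : exists x : R, law_tauK w v n C = x%:E by exists (fine (law_tauK w v n C)); rewrite fineK.
have xn C : exists x : R, law_xtilde w v rho n C = x%:E by exists (fine (law_xtilde w v rho n C)); rewrite fineK.
have [x1 e1] := xm B; have [x2 e2] := xm (~` B).
have [y1 f1] := xn B; have [y2 f2] := xn (~` B).
have := tauK_setC B; have := xtilde_setC B.
have := xtilde_le_tauK B; have := xtilde_le_tauK (~` B).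
rewrite e1 e2 f1 f2 -EFinB abse_EFin -!EFinD !lee_fin ler_norml => h1 h2 [h3] [h4].
move: h1 h2 h3 h4; lra.
Qed.

Lemma dTV_le : (dTV (law_tauK w v n) (law_xtilde w v rho n) <= (20 * e)%:E)%E.
Proof. by apply: ge_ereal_sup => _ [B _ <-]; exact: law_dist. Qed.

Lemma tauK_far : (law_tauK w v n far <= (40 * e)%:E)%E.
Proof.
have pm : (0 <= law_tauK w v n far)%E by apply: esum_ge0 => s _; rewrite lee_fin gibbs_ge0.
have pn : (0 <= law_xtilde w v rho n far)%E by apply: esum_ge0 => s _; exact: xtilde_pmf_ge0.
have fm : law_tauK w v n far \is a fin_num.
  rewrite ge0_fin_numE// (@le_lt_trans _ _ 1%E) ?ltry//.
  by rewrite -(tauK_setC far) leeDl//; apply: esum_ge0 => s _; rewrite lee_fin gibbs_ge0.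
have fn : law_xtilde w v rho n far \is a fin_num.
  by rewrite ge0_fin_numE// (le_lt_trans xtilde_far)// ltry.
have := law_dist far; have := xtilde_far.
have [x ->] : exists x : R, law_tauK w v n far = x%:E by exists (fine (law_tauK w v n far)); rewrite fineK.
have [y ->] : exists y : R, law_xtilde w v rho n far = y%:E by exists (fine (law_xtilde w v rho n far)); rewrite fineK.
rewrite -EFinB abse_EFin !lee_fin ler_norml => h1 /andP[h2 h3].
move: h1 h3; lra.
Qed.

(** [gibbs] vanishes on the empty sequence and on sequences whose sum is not [n]. *)
Lemma gibbs_prob_le (B C : set (seq nat)) :
  (forall s, B s -> s != [::] -> sumn s = n -> C s) ->
  (gibbs_prob w v n B <= gibbs_prob w v n C)%E.
Proof.
move=> BC; rewrite /gibbs_prob [leLHS]esum_mkcond [leRHS]esum_mkcond.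
apply: le_esum => s _; case: ifPn => [/set_mem Bs|_]; last first.
  by case: ifP => // _; rewrite lee_fin gibbs_ge0.
have [Cs|Cs] := boolP (s \in C); first by [].
rewrite /gibbs; case: ifPn => // /andP[s0 /eqP sn]; case/negP: Cs; apply/mem_set.
by apply: BC => //; rewrite -size_eq0 -lt0n.
Qed.

(** Both events force [sumn (tau s) > d * n]: the first because [1 - K_(1)/n = sumn (tau s) / n],
    the second by [Kord1_tau]. *)
Lemma gibbs_max_far (y : R) : d <= y ->
  (gibbs_prob w v n [set s | (y < `|(Kord 0 s)%:R / n%:R - 1|)%R] <= (40 * e)%:E)%E /\
  (gibbs_prob w v n [set s | (y < (Kord 1 s)%:R / n%:R)%R] <= (40 * e)%:E)%E.
Proof.
move=> dy; have n0 : 0 < n%:R :> R by rewrite ltr0n.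
split; apply: le_trans tauK_far; apply: gibbs_prob_le => s /= + s0 sn.
  have := Kord0_tau s s0; rewrite sn => Kn.
  have -> : (Kord 0 s)%:R / n%:R - 1 = - ((sumn (tau s))%:R / n%:R) :> R.
    by rewrite -Kn natrD; field; rewrite -natrD Kn gt_eqF.
  rewrite normrN ger0_norm ?divr_ge0// => h; rewrite /far /= -ltr_pdivlMr//.
  exact: le_lt_trans h.
move=> h; rewrite /far /= -ltr_pdivlMr//; apply: le_lt_trans dy _; apply: lt_le_trans h _.
by rewrite ler_pM2r ?invr_gt0// ler_nat; exact: Kord1_tau.
Qed.

End FixedSize.

(** * Asymptotics *)

Section Asymptotics.
Context (R : realType) (w v : nat -> R) (rho alpha : R) (Lw Lv : R -> R).
Hypothesis w_ge0 : forall n, 0 <= w n.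
Hypothesis v_ge0 : forall k, (1 <= k)%N -> 0 <= v k.
Hypothesis rho_gt0 : 0 < rho.
Hypothesis svw : slowly_varying Lw.
Hypothesis svv : slowly_varying Lv.
Hypothesis w_asymp : asymp_equiv w (fun n => Lw n%:R * n%:R^-1 * rho ^- n).
Hypothesis W_fin : (0 < Wval w rho < +oo)%E.
Let W := fine (Wval w rho).
Hypothesis v_asymp : asymp_equiv v (fun n => Lv n%:R * powR n%:R (alpha - 1) * W ^- n).
Let p := pX w rho.
Let q k := v k * W ^+ k.

Lemma W_gt0 : 0 < fine (Wval w rho).
Proof. exact: fine_gt0. Qed.

Lemma pX_sum1 : \sum_(j < n) pX w rho j @[n --> \oo] --> (1 : R).
Proof.
have /andP[W0 Woo] := W_fin.
have Wf : Wval w rho \is a fin_num by rewrite ge0_fin_numE// ltW.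
have cW : (\sum_(0 <= m < n) (w m * rho ^+ m)%:E)%E @[n --> \oo] --> (W%:E : \bar R).
  rewrite fineK//; apply: is_cvg_nneseries => m _ _.
  by rewrite lee_fin mulr_ge0// exprn_ge0// ltW.
have {}cW : \sum_(0 <= m < n) w m * rho ^+ m @[n --> \oo] --> W.
  move/fine_cvg : cW; apply: cvg_trans; apply: near_eq_cvg; near=> n.
  by rewrite /= sumEFin.
rewrite (_ : (1 : R) = W * W^-1); last by rewrite divff// gt_eqF// W_gt0.
apply: cvg_trans (cvgM cW (cvg_cst W^-1)); apply: near_eq_cvg; near=> n.
by rewrite /= big_mkord mulr_suml.
Unshelve. all: by end_near. Qed.

(** The tilt cancels [rho^(-n)], so [n * p n] is asymptotic to [Lw n / W]. *)
Lemma wt_window : window R (wt R (pX w rho)).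
Proof.
apply: (slowly_varying_window R Lw _ W^-1 svw); first by rewrite invr_gt0 W_gt0.
have h : w n / (Lw n%:R * n%:R^-1 * rho ^- n) * W^-1 @[n --> \oo] --> W^-1.
  rewrite -[X in _ --> X]mul1r; apply: cvgM; first exact: w_asymp.
  exact: cvg_cst.
apply: cvg_trans h; apply: near_eq_cvg; near=> n.
by rewrite /= /wt /pX -/W !invfM !invrK; ring.
Unshelve. all: by end_near. Qed.

(** The power [k^(1 - alpha)] strips [q] down to its slowly varying part. *)
Lemma q_window : window R (fun k => q k * powR k%:R (1 - alpha)).
Proof.
apply: (slowly_varying_window R Lv _ 1 svv ltr01).
apply: cvg_trans v_asymp; apply: near_eq_cvg; near=> n.
have n0 : (0 < n)%N by near: n; exact: nbhs_infty_gt.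
rewrite /= !invfM invrK -powRN opprB /q; ring.
Unshelve. all: by end_near. Qed.

Lemma powR_dyadic (x y : R) : 0 < x -> x <= y <= 2 * x ->
  powR y alpha <= expR (`|alpha| * ln 2) * powR x alpha.
Proof.
move=> x0 /andP[xy yx]; have y0 : 0 < y by exact: lt_le_trans xy.
rewrite /powR !gt_eqF// -expRD ler_expR.
have l1 : ln x <= ln y by rewrite ler_ln.
have l2 : ln y <= ln 2 + ln x by rewrite -lnM ?posrE// ler_ln// posrE mulr_gt0.
have h : alpha * (ln y - ln x) <= `|alpha| * (ln y - ln x).
  by rewrite ler_wpM2r ?subr_ge0// ler_norm.
have : `|alpha| * (ln y - ln x) <= `|alpha| * ln 2 by rewrite ler_wpM2l//; lra.
lra.
Qed.

Lemma kq_powR k : (0 < k)%N ->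
  k%:R * q k = q k * powR k%:R (1 - alpha) * powR k%:R alpha.
Proof.
move=> k0; rewrite -mulrA -powRD ?subrK ?powRr1 1?mulrC//.
by rewrite pnatr_eq0 -lt0n k0 implybT.
Qed.

(** The indices [2k+1] and [2k+2] both lie between [k+1] and [2(k+1)]; the window with tolerance 1
    gives the factor 2 and [powR_dyadic] the rest. *)
Lemma kq_doubling : exists K C, forall k, (K <= k)%N ->
  (2 * k).+1%:R * q (2 * k).+1 <= C * (k.+1%:R * q k.+1) /\
  (2 * k).+2%:R * q (2 * k).+2 <= C * (k.+1%:R * q k.+1).
Proof.
have [N HN] := q_window _ ltr01.
exists N, (2 * expR (`|alpha| * ln 2)) => k Nk.
suff H j : (k.+1 <= j <= 2 * k.+1)%N ->
    j%:R * q j <= 2 * expR (`|alpha| * ln 2) * (k.+1%:R * q k.+1).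
  by split; apply: H; lia.
move=> /andP[kj jk]; rewrite !kq_powR//; last by lia.
have [||aj ak _ h] := HN j k.+1; [lia|by rewrite kj|].
rewrite [leRHS](_ : _ = (2 * (q k.+1 * powR k.+1%:R (1 - alpha))) *
  (expR (`|alpha| * ln 2) * powR k.+1%:R alpha)); last by ring.
apply: ler_pM; [exact: ltW|exact: powR_ge0|by move: h; rewrite -natr1|].
by apply: powR_dyadic; rewrite ?ltr0n// -natrM !ler_nat kj.
Qed.

Lemma kq_gt0 : exists k, 0 < k.+1%:R * q k.+1.
Proof.
have [N HN] := q_window _ ltr01; exists N.
have [||h _ _ _] := HN N.+1 N.+1; [lia|lia|].
by rewrite kq_powR// mulr_gt0// powR_gt0// ltr0n.
Qed.

Lemma gibbs_approx (e d : R) : 0 < e <= 1 / 2 -> 0 < d <= 1 / 3 ->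
  exists N, forall n, (N <= n)%N -> (0 < u_seq w v n < +oo)%E ->
  (dTV (law_tauK w v n) (law_xtilde w v rho n) <= (20 * e)%:E)%E /\
  forall y : R, d <= y ->
  (gibbs_prob w v n [set s | (y < `|(Kord 0 s)%:R / n%:R - 1|)%R] <= (40 * e)%:E)%E /\
  (gibbs_prob w v n [set s | (y < (Kord 1 s)%:R / n%:R)%R] <= (40 * e)%:E)%E.
Proof.
move=> /andP[e0 e2] /andP[d0 d3].
have p0 := pX_ge0 R w rho w_ge0 rho_gt0 W_gt0.
have q0 k : 0 <= q k.+1 by rewrite mulr_ge0 ?v_ge0// exprn_ge0// ltW// W_gt0.
have [N HN] := core R p q p0 pX_sum1 wt_window q0 kq_doubling kq_gt0 e d e0 d0.
exists N.+1 => n Nn u_fin; have n0 : (0 < n)%N by exact: leq_trans Nn.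
have [pn + [A [r]]] := HN n (ltnW Nn).
rewrite /abel (_ : 1 - tail R p n = \sum_(j < n.+1) p j); last first.
  by rewrite /tail opprB addrC subrK.
move=> F0 [A0 AE sh [r0 rs ra] mean].
split; first exact: (dTV_le R w v rho n w_ge0 v_ge0 rho_gt0 W_gt0 u_fin F0 e d A r
  n0 e0 e2 d0 d3 pn sh A0 AE r0 rs ra mean).
exact: (gibbs_max_far R w v rho n w_ge0 v_ge0 rho_gt0 W_gt0 u_fin F0 e d A r
  n0 e0 e2 d0 d3 pn sh A0 AE r0 rs ra mean).
Qed.

End Asymptotics.

Theorem theorem1p2 (R : realType) (w v : nat -> R) (rho alpha : R)
    (Lw Lv : R -> R) :
  (forall n, 0 <= w n) ->
  (forall k, (1 <= k)%N -> 0 <= v k) ->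
  0 < rho -> -1 < alpha ->
  slowly_varying Lw -> slowly_varying Lv ->
  asymp_equiv w (fun n => Lw n%:R * n%:R^-1 * rho ^- n) ->
  (0 < Wval w rho < +oo)%E ->
  asymp_equiv v (fun n => Lv n%:R * powR n%:R (alpha - 1) * fine (Wval w rho) ^- n) ->
  (* d_TV( L(tau(K_1..K_{N_n})), L(tilde X_1..tilde X_{N_n-1}) ) -> 0 *)
  (forall eps : R, 0 < eps -> exists N : nat, forall n : nat, (N <= n)%N ->
     (0 < u_seq w v n < +oo)%E ->
     (dTV (law_tauK w v n) (law_xtilde w v rho n) < eps%:E)%E) /\
  (* K_(1) / n -> 1 in probability *)
  (forall eps : R, 0 < eps -> forall delta : R, 0 < delta ->
     exists N : nat, forall n : nat, (N <= n)%N ->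
     (0 < u_seq w v n < +oo)%E ->
     (gibbs_prob w v n [set s | (eps < `|(Kord 0 s)%:R / n%:R - 1|)%R ] < delta%:E)%E) /\
  (* K_(2) / n -> 0 in probability *)
  (forall eps : R, 0 < eps -> forall delta : R, 0 < delta ->
     exists N : nat, forall n : nat, (N <= n)%N ->
     (0 < u_seq w v n < +oo)%E ->
     (gibbs_prob w v n [set s | (eps < (Kord 1 s)%:R / n%:R)%R ] < delta%:E)%E).
Proof.
move=> w0 v0 rho0 _ svw svv wa Wf va.
have approx := gibbs_approx R w v rho alpha Lw Lv w0 v0 rho0 svw svv wa Wf va.
have third : 0 < (1 / 3 : R) <= 1 / 3 by rewrite lexx andbT divr_gt0.
(* The margin [40 * e < x] serves both the total variation bound [20 * e] and the probability bounds
   [40 * e]. *)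
have small (x : R) : 0 < x -> exists e : R, 0 < e <= 1 / 2 /\ 40 * e < x.
  move=> x0; exists (Num.min (1 / 2) (x / 80)); split.
    by rewrite lt_min ge_min lexx /= andbT !divr_gt0.
  have : Num.min (1 / 2) (x / 80) <= x / 80 by rewrite ge_min lexx orbT.
  lra.
have dmin (y : R) : 0 < y -> exists d : R, 0 < d <= 1 / 3 /\ d <= y.
  move=> y0; exists (Num.min (1 / 3) y); rewrite lt_min !ge_min !lexx y0 /= orbT.
  by split => //; lra.
split; [|split].
- move=> eps /small[e [e2 ee]]; have [N HN] := approx _ _ e2 third.
  exists N => n Nn un; have [h _] := HN n Nn un; apply: (le_lt_trans h).
  by rewrite lte_fin; case/andP: e2 => ? _; lra.
- move=> eps /dmin[d [d3 de]] delta /small[e [e2 ee]]; have [N HN] := approx _ _ e2 d3.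
  exists N => n Nn un; have [_ /(_ _ de)[h _]] := HN n Nn un.
  by apply: (le_lt_trans h); rewrite lte_fin.
- move=> eps /dmin[d [d3 de]] delta /small[e [e2 ee]]; have [N HN] := approx _ _ e2 d3.
  exists N => n Nn un; have [_ /(_ _ de)[_ h]] := HN n Nn un.
  by apply: (le_lt_trans h); rewrite lte_fin.
Qed.
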